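(* There exists a constant $C$ such that for all $s,k\in\mathbb{N}$, every $K_{s,s}$-free graph $G$ with average degree at least $k^{Cs^3}$ contains an induced subgraph which is $C_4$-free and has average degree at least $k$.
   Context: All graphs are finite, simple and loopless. The average degree of a graph $G$ is $d(G)=2|E(G)|/|V(G)|$. For a graph $H$, a graph is $H$-free if it contains no (not necessarily induced) subgraph isomorphic to $H$. $K_{s,s}$ is the complete bipartite graph with both parts of size $s$, and $C_4$ is the cycle on four vertices. *)

(* Defs.v *)
From mathcomp Require Import all_boot all_order all_algebra.

Set Implicit Arguments.
Unset Strict Implicit.
Unset Printing Implicit Defensive.

Import Order.TTheory GRing.Theory Num.Theory.

Record sgraph := SGraph {
  vertex :> finType;
  adj : rel vertex;
  adj_sym : symmetric adj;
  adj_irrefl : irreflexive adj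
}.

Definition edges (G : sgraph) : {set {set G}} :=
  [set e : {set G} | [exists x : G, exists y : G, adj x y && (e == [set x; y])]].

(* Division by zero gives the graph with no vertices average degree 0. *)
Definition avg_degree (G : sgraph) : rat :=
  ((2 * #|edges G|)%:R / #|G|%:R)%R.

Section Induced.
Variables (G : sgraph) (S : {set G}).

Definition induced_adj : rel {x : G | x \in S} :=
  fun u v => adj (val u) (val v).

Lemma induced_adj_sym : symmetric induced_adj.
Proof. by move=> u v; apply: adj_sym. Qed.

Lemma induced_adj_irrefl : irreflexive induced_adj.
Proof. by move=> u; apply: adj_irrefl. Qed.

Definition induced : sgraph := SGraph induced_adj_sym induced_adj_irrefl.
End Induced.

(* Not necessarily induced: f only has to preserve adjacency. *)
Definition contains_subgraph (H G : sgraph) : Prop :=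
  exists f : H -> G, injective f /\ forall x y : H, adj x y -> adj (f x) (f y).

Definition free_of (H G : sgraph) : Prop := ~ contains_subgraph H G.

Section CompleteBipartite.
Variables m n : nat.

Definition Kmn_adj : rel ('I_m + 'I_n)%type :=
  fun u v => match u, v with
             | inl _, inr _ | inr _, inl _ => true
             | _, _ => false
             end.

Lemma Kmn_adj_sym : symmetric Kmn_adj.
Proof. by case=> i [j|j]. Qed.

Lemma Kmn_adj_irrefl : irreflexive Kmn_adj.
Proof. by case. Qed.

Definition Kmn : sgraph := SGraph Kmn_adj_sym Kmn_adj_irrefl.
End CompleteBipartite.

Definition C4_adj : rel 'I_4 :=
  fun i j => (j == i.+1 %% 4 :> nat) || (i == j.+1 %% 4 :> nat).

Lemma C4_adj_sym : symmetric C4_adj.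
Proof. by move=> i j; rewrite /C4_adj orbC. Qed.

Lemma C4_adj_irrefl : irreflexive C4_adj.
Proof. by case=> [[|[|[|[|//]]]] ?]. Qed.

Definition C4 : sgraph := SGraph C4_adj_sym C4_adj_irrefl.

(* Main.v *)
Require Import Defs.
From mathcomp Require Import all_boot all_order all_algebra.
From mathcomp Require Import zify ring lra.

(** Let d = k^(C s^3). Inside G there is a set S of average degree at least d all of
    whose subsets have average degree at most 2d. Peel S into levels
    S = H_0, H_1, H_2, ... where H_(i+1) consists of the vertices of H_i having at
    least 2 d lam neighbours in H_i, so that |H_i| <= |S| / lam^i. At least a
    quarter of the edges leave the bottom shell L = H_0 \ H_1.
    - If many of them go to a single shell H = H_i \ H_(i+1), all degrees inside L
      and inside H are O(d lam). By Kovari-Sos-Turan each vertex lies in fewer than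
      d^3 dangerous 4-cycles, and a random sample of rate about 1/d destroys every
      4-cycle except those that alternate between L and H.
    - Otherwise many go to H = H_m with |L| > lam^m |H| / 128. This gap is large enough
      to afford a sample of H that is independent and in which many vertices of L
      have an exactly prescribed independent neighbourhood.
    In both cases L is much larger than H and only alternating 4-cycles are left.
    These are removed by induction on s. Call a pair of H heavy if it has many
    common neighbours in L. If few pairs inside the neighbourhoods of L-vertices are
    heavy, thin out H so that many of them contain no heavy pair at all, and then
    take a set in L no two of whose vertices have two common neighbours.
    Otherwise some x in H forms heavy pairs with a large part of the neighbourhood of
    many v in L; restricting L to these v, and H to the heavy partners of x,
    replaces K_{s,s} by K_{s-1,s}. *)

Set Implicit Arguments.
Unset Strict Implicit.
Unset Printing Implicit Defensive.
Import Order.TTheory GRing.Theory Num.Theory.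

(** * Edge counts and dense bipartite graphs *)

(** Repeatedly pick a vertex of low degree and delete it together with its at most [D] neighbours.
    Since [r] may relate a vertex to itself, only distinct members of [I] are compared. *)
Lemma greedy_independent (T : finType) (r : rel T) (D : nat) (W : {set T}) :
  symmetric r ->
  (forall U : {set T}, U \subset W -> U != set0 ->
     exists2 v, v \in U & #|[set u in U | r v u]| <= D) ->
  exists I : {set T}, [/\ I \subset W, {in I &, forall u v, u != v -> ~~ r u v}
     & #|W| <= D.+1 * #|I|].
Proof.
move=> rC; have [n] := ubnP #|W|; elim: n W => // n IH W /ltnSE leWn sparse.
have [->|W0] := eqVneq W set0.
  by exists set0; split; rewrite ?sub0set ?cards0 // => u v; rewrite inE.
have [v vW degv] := sparse W (subxx _) W0.
pose W' := [set u in W | (u != v) && ~~ r v u].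
have W'W : W' \subset W by apply/subsetP=> u; rewrite inE => /andP[].
have ltW' : #|W'| < #|W|.
  by apply: proper_card; apply/properP; split=> //; exists v; rewrite // inE eqxx andbF.
have [||I [IW' Iind cardI]] := IH W'; first exact: leq_trans ltW' leWn.
  by move=> U UW'; apply: sparse; apply: subset_trans UW' W'W.
have vI : v \notin I by apply/negP=> /(subsetP IW'); rewrite inE eqxx andbF.
exists (v |: I); split.
- by rewrite subUset sub1set vW (subset_trans IW' W'W).
- move=> x y; rewrite !inE => /orP[/eqP->|xI] /orP[/eqP->|yI]; rewrite ?eqxx //.
  + by move=> _; have := subsetP IW' _ yI; rewrite inE => /and3P[].
  + by move=> _; have := subsetP IW' _ xI; rewrite inE rC => /and3P[].
  + exact: Iind.
- rewrite cardsU1 vI.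
  have : #|W| <= #|W'| + #|v |: [set u in W | r v u]|.
    rewrite -(cardsID W' W).
    apply: leq_add; apply: subset_leq_card; apply/subsetP=> u; rewrite !inE.
      by case/andP.
    by rewrite andbC => /andP[->] /=; rewrite negb_and !negbK.
  rewrite cardsU1; move: (v \notin _) => []; lia.
Qed.

Section Counting.
Variable G : sgraph.
Implicit Types (A B L H S T P Q : {set G}) (x y v : G).

Definition nbr A x : {set G} := [set y in A | adj x y].

(* Ordered pairs: epairs S S / #|S| is the average degree of the graph induced on S. *)
Definition epairs A B : nat := \sum_(x in A) #|nbr B x|.

Lemma in_nbr A x y : (y \in nbr A x) = (y \in A) && adj x y.
Proof. by rewrite inE. Qed.

Lemma nbr_sub A x : nbr A x \subset A.
Proof. by apply/subsetP=> y; rewrite in_nbr => /andP[]. Qed.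

Lemma nbrS A B x : A \subset B -> nbr A x \subset nbr B x.
Proof. by move=> AB; apply/subsetP=> y; rewrite !in_nbr => /andP[/(subsetP AB)-> ->]. Qed.

Lemma card_nbrE A x : #|nbr A x| = \sum_(y in A) adj x y.
Proof.
rewrite -sum1_card big_mkcond [RHS]big_mkcond; apply: eq_bigr => y _.
by rewrite in_nbr; case: (y \in A); case: adj.
Qed.

Lemma epairsC A B : epairs A B = epairs B A.
Proof.
rewrite /epairs (eq_bigr _ (fun x _ => card_nbrE B x)).
rewrite exchange_big /=; apply: eq_bigr => y _.
by rewrite card_nbrE; apply: eq_bigr => x _; rewrite adj_sym.
Qed.

Lemma epairsS A A' B B' : A \subset A' -> B \subset B' -> epairs A B <= epairs A' B'.
Proof.
move=> AA' BB'; rewrite /epairs [X in _ <= X](big_setID A) /= (setIidPr AA').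
rewrite (leq_trans _ (leq_addr _ _)) //; apply: leq_sum => x _.
exact: subset_leq_card (nbrS _ BB').
Qed.

Lemma epairs_setID C A B : epairs A B = epairs (A :&: C) B + epairs (A :\: C) B.
Proof. exact: big_setID. Qed.

Lemma epairs_leq A B (c : nat) :
  {in A, forall x, #|nbr B x| <= c} -> epairs A B <= c * #|A|.
Proof. by move=> le_c; rewrite mulnC -sum_nat_const; apply: leq_sum. Qed.

Lemma epairs_geq A B (c : nat) :
  {in A, forall x, c <= #|nbr B x|} -> c * #|A| <= epairs A B.
Proof. by move=> le_c; rewrite mulnC -sum_nat_const; apply: leq_sum. Qed.

Lemma epairsD1 A B x : x \in A -> epairs A B = #|nbr B x| + epairs (A :\ x) B.
Proof. by move=> xA; rewrite /epairs (big_setD1 x). Qed.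

Lemma epairs_disjointU A B : [disjoint A & B] ->
  epairs (A :|: B) (A :|: B) = epairs A A + 2 * epairs A B + epairs B B.
Proof.
move=> dAB; have idl C : epairs (A :|: B) C = epairs A C + epairs B C.
  rewrite (epairs_setID A) setUK; congr (_ + epairs _ _).
  by rewrite setDUl setDv set0U; apply/setDidPl; rewrite disjoint_sym.
by rewrite idl !(epairsC _ (A :|: B)) !idl (epairsC B A); lia.
Qed.

(* Deleting vertices of too small degree only increases e(L,H) - a|L| - b|H|. *)
Lemma min_degree_pair (a b : nat) L H : a * #|L| + b * #|H| < epairs L H ->
  exists L' H', [/\ L' \subset L, H' \subset H, 0 < #|L'|,
    {in L', forall v, a <= #|nbr H' v|} & {in H', forall x, b <= #|nbr L' x|}].
Proof.
have [n] := ubnP (#|L| + #|H|); elim: n L H => // n IH L H /ltnSE leLHn elt.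
have [/exists_inP[v vL ltv]|/exists_inPn degL] := boolP [exists v in L, #|nbr H v| < a].
  have cL := cardsD1 v L; rewrite vL in cL.
  have [||L' [H' [L'L H'H ? ? ?]]] := IH (L :\ v) H.
  - lia.
  - by move: elt; rewrite (epairsD1 _ vL) cL mulnDr; lia.
  by exists L', H'; split=> //; apply: subset_trans L'L (subsetDl _ _).
have [/exists_inP[x xH ltx]|/exists_inPn degH] := boolP [exists x in H, #|nbr L x| < b].
  have cH := cardsD1 x H; rewrite xH in cH.
  have [||L' [H' [L'L H'H ? ? ?]]] := IH L (H :\ x).
  - lia.
  - by move: elt; rewrite epairsC (epairsD1 _ xH) cH mulnDr (epairsC L); lia.
  by exists L', H'; split=> //; apply: subset_trans H'H (subsetDl _ _).
exists L, H; split=> //.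
- rewrite lt0n cards_eq0; apply/eqP=> L0.
  by rewrite L0 /epairs big_set0 in elt.
- by move=> v vL; rewrite leqNgt; apply: degL.
- by move=> x xH; rewrite leqNgt; apply: degH.
Qed.

(** Being hereditary, this bound on average degrees yields degeneracy: every nonempty subset has a
    vertex of degree at most [d]. *)
Definition sparse (d : nat) S := forall T, T \subset S -> epairs T T <= d * #|T|.

Lemma sparse_sub d S S' : S' \subset S -> sparse d S -> sparse d S'.
Proof. by move=> S'S spS T TS'; apply: spS; apply: subset_trans TS' S'S. Qed.

Lemma sparse_low_degree d S : sparse d S -> S != set0 ->
  exists2 v, v \in S & #|nbr S v| <= d.
Proof.
move=> spS /set0Pn[x xS].
have [/exists_inP[v vS dv]|/exists_inPn hi] := boolP [exists v in S, #|nbr S v| <= d].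
  by exists v.
have := spS S (subxx _); have : d.+1 * #|S| <= epairs S S.
  by apply: epairs_geq => v vS; rewrite ltnNge hi.
have : 0 < #|S| by apply/card_gt0P; exists x.
nia.
Qed.

Lemma sparse_independent d S : sparse d S -> exists I : {set G},
  [/\ I \subset S, {in I &, forall u v, ~~ adj u v} & #|S| <= d.+1 * #|I|].
Proof.
move=> spS; have [U US U0|I [IS Iind cI]] := @greedy_independent G (@adj G) d S (@adj_sym G).
  have [v vU dv] := sparse_low_degree (sparse_sub US spS) U0.
  by exists v.
exists I; split=> // u v uI vI; have [->|] := eqVneq u v; first by rewrite adj_irrefl.
exact: Iind.
Qed.

(** Delete low-degree vertices one at a time, each pointing to its neighbours still present. Only
    the covering of edges is recorded, so the later use intersects [out v] with the true
    neighbourhood of [v]. *)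
Lemma sparse_orientation d S : sparse d S -> exists out : G -> {set G},
  {in S, forall v, #|out v| <= d} /\
  {in S &, forall u v, adj u v -> (v \in out u) || (u \in out v)}.
Proof.
have [n] := ubnP #|S|; elim: n S => // n IH S /ltnSE leSn spS.
have [->|S0] := eqVneq S set0.
  by exists (fun=> set0); split=> [v|u v]; rewrite inE.
have [v vS dv] := sparse_low_degree spS S0.
have [||out [outd outP]] := IH (S :\ v).
- by move: leSn; rewrite (cardsD1 v S) vS.
- exact: sparse_sub (subsetDl _ _) spS.
exists (fun x => if x == v then nbr S v else out x); split.
  move=> x xS; case: eqVneq => // nxv; apply: outd; by rewrite !inE nxv.
move=> x y xS yS xy; case: (eqVneq x v) => [xv|nxv].
  by rewrite in_nbr yS -xv xy.
case: (eqVneq y v) => [yv|nyv]; first by rewrite in_nbr xS -yv adj_sym xy orbT.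
by apply: outP; rewrite // !inE ?nxv ?nyv.
Qed.

(** Sparsity of L' together with H gives e(L',H) <= d|L'| + d|H|. Since 4d|L'| <= e(L',H), the first
    term is at most a quarter of the left side. *)
Lemma sparse_high_degree d S L H : sparse (2 * d) S -> L \subset S -> H \subset S ->
  [disjoint L & H] ->
  epairs [set v in L | 4 * d < #|nbr H v|] H <= 2 * d * #|H|.
Proof.
move=> spS LS HS dLH; set L' := [set v in L | _].
have L'L : L' \subset L by apply/subsetP=> v; rewrite inE => /andP[].
have dL'H : [disjoint L' & H] by apply: disjointWl dLH.
have := spS (L' :|: H); rewrite subUset (subset_trans L'L LS) HS => /(_ isT).
rewrite epairs_disjointU // cardsU (disjoint_setI0 dL'H) cards0 subn0.
have : (4 * d) * #|L'| <= epairs L' H.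
  by apply: epairs_geq => v; rewrite inE => /andP[_ /ltnW].
nia.
Qed.

(** Two completely joined sets are automatically disjoint in a loopless graph. *)
Definition biclique_free (s : nat) := forall T U : {set G},
  s <= #|T| -> s <= #|U| -> ~ {in T & U, forall x y, adj x y}.

Definition common A T : {set G} := [set y in A | [forall x in T, adj x y]].

Lemma biclique_free_common s A T : biclique_free s -> #|T| = s -> #|common A T| < s.
Proof.
move=> fr cT; rewrite ltnNge; apply/negP=> le_s.
apply: (fr T (common A T)); rewrite ?cT // => x y xT; rewrite inE => /andP[_ /forall_inP]; exact.
Qed.

(* Averaging: some p in P is adjacent to a 1/g fraction of Q; pick such vertices one at a time. *)
Lemma common_of_dense (g b N t : nat) P Q : 0 < g -> 0 < b -> 0 < N -> #|P| <= g * b ->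
  g ^ t * N <= #|Q| -> {in Q, forall y, b + t <= #|nbr P y|} ->
  exists T : {set G}, [/\ T \subset P, #|T| = t & N <= #|common Q T|].
Proof.
move=> g0 b0 N0; elim: t P Q => [|t IH] P Q leP leQ degQ.
  exists set0; rewrite ?cards0 ?sub0set //; split=> //; move: leQ; rewrite mul1n => /leq_trans; apply.
  apply/subset_leq_card/subsetP=> y yQ; rewrite inE yQ.
  by apply/forall_inP=> x; rewrite inE.
have gtN : 0 < g ^ t * N by rewrite muln_gt0 expn_gt0 g0.
(* If every [p] falls short, counting the pairs between [P] and [Q] from both sides contradicts |P|
   <= g b. *)
have [/exists_inP[p pP degp]|/exists_inPn low] :=
  boolP [exists p in P, g ^ t * N <= #|nbr Q p|]; last first.
  have le1 : (b + t.+1) * #|Q| <= epairs Q P by apply: epairs_geq.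
  have le2 : epairs P Q <= (g ^ t * N).-1 * #|P|.
    by apply: epairs_leq => y /low; rewrite -ltnNge; lia.
  move: le1 le2 leQ leP; rewrite epairsC expnS -mulnA; move: (g ^ t * N) gtN => M.
  by case: M => // M _ /=; nia.
have [||T [TP cT leT]] := IH (P :\ p) (nbr Q p) _ degp.
- by rewrite (leq_trans _ leP) // subset_leq_card ?subsetDl.
(* Passing to [P :\ p] costs each [y] one neighbour; the surplus [t] in the degree bound pays for
   it. *)
- move=> y; rewrite in_nbr => /andP[yQ py]; move: (degQ y yQ).
  rewrite (cardsD1 p (nbr P y)) in_nbr pP adj_sym py addnS ltnS => /leq_trans; apply.
  by apply/subset_leq_card/subsetP=> z; rewrite !inE => /and3P[-> ->].
exists (p |: T); split.
- by rewrite subUset sub1set pP (subset_trans TP (subsetDl _ _)).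
- by rewrite cardsU1 cT; case: (boolP (p \in T)) => // /(subsetP TP); rewrite !inE eqxx.
apply: leq_trans leT _; apply/subset_leq_card/subsetP=> y; rewrite !inE.
move=> /andP[/andP[-> py] /forall_inP adjT]; apply/forall_inP=> z; rewrite !inE.
by case/orP=> [/eqP->//|]; apply: adjT.
Qed.

(* Kovari, Sos and Turan, with g playing the role of the saving D^(1/s). *)
Lemma biclique_free_epairs s (g D : nat) P Q : 0 < s -> 0 < g -> biclique_free s ->
  #|P| <= D -> #|Q| <= D -> 2 * g * ((8 * g) ^ s * s) <= D ->
  g * epairs P Q <= D ^ 2.
Proof.
move=> s0 g0 fr leP leQ leD; rewrite leqNgt; apply/negP=> dense.
(* Vertices outside Q' account for at most D^2/(2g) pairs, so if the claim fails then Q' carries the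
   rest and has more than D/(2g) elements. *)
pose Q' := [set y in Q | D <= 2 * g * #|nbr P y|].
have Q'Q : Q' \subset Q by apply/subsetP=> y; rewrite inE => /andP[].
have pow : 8 * g <= (8 * g) ^ s by rewrite -{1}(expn1 (8 * g)) leq_pexp2l //; lia.
have hQ' : D < 2 * g * #|Q'|.
  have e1 : epairs Q' P <= D * #|Q'|.
    by apply: epairs_leq => y _; rewrite (leq_trans _ leP) // subset_leq_card ?nbr_sub.
  have e2 : 2 * g * epairs (Q :\: Q') P <= D * #|Q|.
    have : 2 * g * epairs (Q :\: Q') P <= D * #|Q :\: Q'|.
      rewrite /epairs big_distrr /= [X in _ <= X]mulnC -sum_nat_const; apply: leq_sum => y.
      by rewrite !inE => /andP[nQ yQ]; move: nQ; rewrite yQ /= -ltnNge => /ltnW.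
    by move/leq_trans; apply; rewrite leq_mul2l subset_leq_card ?subsetDl ?orbT.
  move: dense; rewrite epairsC (epairs_setID Q') (setIidPr Q'Q) expnS expn1.
  nia.
have leQ' : (8 * g) ^ s * s <= #|Q'| by nia.
have sD : 4 * g * s <= D by nia.
(* With this [b], degrees of at least D/(2g) leave room for b + s, while |P| <= D <= 8 g b; hence
   the density parameter [8 * g] below. *)
pose b := D %/ (4 * g).
have bs : s <= b by rewrite leq_divRL; nia.
have Db : D < b.+1 * (4 * g) by apply: ltn_ceil; lia.
have bD : b * (4 * g) <= D by apply: leq_trunc_div.
have [|||||T [_ cT leT]] := @common_of_dense (8 * g) b s s P Q' _ _ _ _ leQ'.
- lia.
- lia.
- lia.
- nia.
- move=> y; rewrite inE => /andP[_]; nia.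
by have := biclique_free_common Q' fr cT; lia.
Qed.

(** The edge bound makes [P] so sparse that at least half of its vertices have degree at most
    |P|/(4c); the greedy choice among these yields [c] independent vertices. *)
Lemma biclique_free_independent s (c : nat) P : 0 < s -> 0 < c -> biclique_free s ->
  2 * (8 * c) * ((8 * (8 * c)) ^ s * s) <= #|P| ->
  exists I : {set G}, [/\ I \subset P, #|I| = c & {in I &, forall u v, ~~ adj u v}].
Proof.
move=> s0 c0 fr leP.
have eP : 8 * c * epairs P P <= #|P| ^ 2.
  by apply: (biclique_free_epairs s0 _ fr) => //; lia.
pose W := [set v in P | 4 * c * #|nbr P v| <= #|P|].
have WP : W \subset P by apply/subsetP=> v; rewrite inE => /andP[].
have P0 : 0 < #|P|.
  by apply: leq_trans leP; rewrite !muln_gt0 expn_gt0; lia.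
have cW : #|P| <= 2 * #|W|.
  have : #|P| * #|P :\: W| <= 4 * c * epairs (P :\: W) P.
    rewrite /epairs big_distrr /= [X in X <= _]mulnC -sum_nat_const; apply: leq_sum => y.
    by rewrite !inE => /andP[nQ yQ]; move: nQ; rewrite yQ /= -ltnNge => /ltnW.
  move: eP; rewrite (epairs_setID W P P) (setIidPr WP) expnS expn1.
  by have := cardsID W P; rewrite (setIidPr WP); nia.
have [|U UW U0|I [IW Iind cI]] := @greedy_independent G (@adj G) (#|P| %/ (4 * c)) W.
- exact: adj_sym.
- have [v vU] := set0Pn _ U0; exists v => //.
  rewrite leq_divRL ?muln_gt0 ?c0 //.
  have := subsetP UW _ vU; rewrite inE => /andP[_]; apply: leq_trans.
  rewrite [X in X <= _]mulnC leq_mul2l; apply/orP; right; apply/subset_leq_card/subsetP=> u.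
  by rewrite !inE => /andP[/(subsetP UW)]; rewrite inE => /andP[-> _].
have cI' : c <= #|I|.
  have le4 : 4 * c <= #|P|.
    apply: leq_trans leP; have : 0 < (8 * (8 * c)) ^ s * s by rewrite muln_gt0 expn_gt0; lia.
    by move: (_ ^ s * s) => M; nia.
  have := leq_trunc_div #|P| (4 * c); move: (_ %/ _) cI => q cI qP.
  rewrite leqNgt; apply/negP=> ltc; have : q.+1 * #|I| <= q.+1 * c by rewrite leq_mul2l ltnW ?orbT.
  nia.
(* Trim to exactly [c] vertices: [sample_exact_traces] needs sets of one common size. *)
have [t [ut st tI]] := card_geqP cI'.
pose J := [set:: t]; have JI : J \subset I by apply/subsetP=> u; rewrite inE => /tI.
have cJ : #|J| = c by rewrite cardsE -st; apply/card_uniqP.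
exists J; split=> //; first exact: subset_trans JI (subset_trans IW WP).
move=> u v /(subsetP JI) uI /(subsetP JI) vI.
have [->|] := eqVneq u v; first by rewrite adj_irrefl.
exact: Iind.
Qed.
End Counting.

(** * Random subsets *)

Section RandomSubset.
Local Open Scope ring_scope.
Variables (R : realFieldType) (V : finType) (p : R).
Implicit Types (A B P : {set V}) (F : {set V} -> R).

(* Every element of V is chosen independently with probability p. *)
Definition expect F : R :=
  \sum_(A : {set V}) (\prod_(x : V) (if x \in A then p else 1 - p)) * F A.

Definition holds (b : bool) : R := b%:R.

(** The indicator is absorbed into the weights by giving weight 0 to omitting an element of [P]; the
    sum of products then becomes a product of sums. *)
Lemma expect_subset P : expect (fun A => holds (P \subset A)) = p ^+ #|P|.
Proof.
rewrite /expect.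
transitivity (\sum_(A : {set V}) \prod_x
    (if x \in A then p else (1 - p) * holds (x \notin P))).
  apply: eq_bigr => A _; have [PA|/subsetPn[x xP xA]] := boolP (P \subset A).
    rewrite mulr1; apply: eq_bigr => x _; case: ifP => // /negbT xA.
    by rewrite (contra (subsetP PA x) xA) mulr1.
  by rewrite mulr0 (bigD1 x) //= (negPf xA) xP mulr0 mul0r.
transitivity (\prod_x (p + (1 - p) * holds (x \notin P))).
  by rewrite bigA_distr; apply: eq_bigl => A; rewrite inE.
rewrite -prodr_const [RHS]big_mkcond /=; apply: eq_bigr => x _.
by case: (x \in P); rewrite /holds; [rewrite mulr0 addr0 | rewrite mulr1 addrC subrK].
Qed.

Lemma expectD F1 F2 : expect (fun A => F1 A + F2 A) = expect F1 + expect F2.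
Proof. by rewrite -big_split; apply: eq_bigr => A _; rewrite mulrDr. Qed.

Lemma expectZ c F : expect (fun A => c * F A) = c * expect F.
Proof. by rewrite big_distrr; apply: eq_bigr => A _; rewrite mulrCA. Qed.

Lemma expectB F1 F2 : expect (fun A => F1 A - F2 A) = expect F1 - expect F2.
Proof.
rewrite -[- expect F2]mulN1r -expectZ -expectD.
by apply: eq_bigr => A _; rewrite mulN1r.
Qed.

Lemma expect_sum (I : finType) (S : {pred I}) (F : I -> {set V} -> R) :
  expect (fun A => \sum_(i in S) F i A) = \sum_(i in S) expect (F i).
Proof.
rewrite /expect exchange_big /=; apply: eq_bigr => A _.
by rewrite big_distrr.
Qed.

Hypothesis p01 : 0 <= p <= 1.

Lemma expect_weight_ge0 A : 0 <= \prod_(x : V) (if x \in A then p else 1 - p).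
Proof. by have /andP[p0 p1] := p01; apply: prodr_ge0 => x _; case: ifP => _; lra. Qed.

Lemma expect_le F1 F2 : (forall A, F1 A <= F2 A) -> expect F1 <= expect F2.
Proof.
by move=> le12; apply: ler_sum => A _; rewrite ler_wpM2l ?expect_weight_ge0.
Qed.

Lemma expect_cst c : expect (fun=> c) = c.
Proof.
transitivity (c * expect (fun A => holds (set0 \subset A))); last first.
  by rewrite expect_subset cards0 mulr1.
by rewrite -expectZ; apply: eq_bigr => A _; rewrite sub0set /holds mulr1.
Qed.

(** The maximum is at least the mean. Each probabilistic existence argument below takes its sample
    from here. *)
Lemma expect_attained F : exists A, expect F <= F A.
Proof.
have [A _ maxA] := @Order.TotalTheory.arg_maxP _ _ _ set0 predT F isT.
exists A; rewrite -[leRHS]expect_cst; apply: expect_le => B; exact: maxA.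
Qed.

End RandomSubset.
Arguments holds {R} b.

(** * Random thinning that destroys heavy pairs *)

Section Heavy.
Variables (R : realFieldType) (G : sgraph).
Implicit Types (A B L H S T : {set G}) (x y v : G).

Definition codegree L x y := #|nbr L x :&: nbr L y|.

Definition heavy_pairs L H (Xi : nat) v : {set G * G} :=
  [set ab : G * G | [&& ab.1 \in nbr H v, ab.2 \in nbr H v, ab.1 != ab.2
                      & Xi <= codegree L ab.1 ab.2]].

Local Open Scope ring_scope.

Lemma sum_holds (T : finType) (B : {set T}) (C : {set T}) :
  \sum_(x in B) holds (x \in C) = #|B :&: C|%:R :> R.
Proof.
rewrite -sum1_card natr_sum big_mkcond [RHS]big_mkcond; apply: eq_bigr => x _.
by rewrite inE; case: (x \in B); case: (x \in C).
Qed.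

Lemma expect_cardI (T : finType) (p : R) (B : {set T}) :
  expect p (fun C : {set T} => #|B :&: C|%:R) = #|B|%:R * p.
Proof.
transitivity (expect p (fun C : {set T} => \sum_(x in B) holds ([set x] \subset C))).
  apply: eq_bigr => C _; rewrite -sum_holds; congr (_ * _).
  by apply: eq_bigr => x _; rewrite sub1set.
rewrite expect_sum; under eq_bigr do rewrite expect_subset cards1 expr1.
by rewrite sumr_const -[LHS]mulr_natl.
Qed.

(** At most two choices of [c] coincide with [a] or [b] and cost p^2; every other choice costs
    p^3. *)
Lemma sum_pow3_le (p : R) (N : {set G}) a b : 0 <= p -> a != b ->
  \sum_(c in N) p ^+ #|[set a; b; c]| <= 2 * p ^+ 2 + #|N|%:R * p ^+ 3.
Proof.
move=> p0 ab.
have le1 c : p ^+ #|[set a; b; c]| <= p ^+ 2 * holds (c \in [set a; b]) + p ^+ 3.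
  rewrite setUC cardsU1 cards2 ab; case: (c \in _) => /=.
    by rewrite mulr1 add0n lerDl exprn_ge0.
  by rewrite mulr0 add0r.
apply: le_trans (ler_sum _ (fun c _ => le1 c)) _.
rewrite big_split /= -big_distrr /= sum_holds sumr_const -[p ^+ 3 *+ _]mulr_natl lerD2r mulrC.
rewrite ler_wpM2r ?exprn_ge0 // ler_nat.
by rewrite (leq_trans (subset_leq_card (subsetIr _ _))) // cards2 ab.
Qed.

(** Sample [H] at rate 16k/nu, so each v in [L1] expects 16k sampled neighbours. The score [F v]
    subtracts a penalty that makes it nonpositive once a heavy pair survives at v; its mean stays at
    least 14k, so a 1/K fraction of [L1] must be good. *)
Lemma thin_out_heavy (L H L1 : {set G}) (Xi K nu kap k : nat) :
  (0 < k)%N -> (64 * 128 * (k * k * kap) <= nu)%N -> (0 < kap)%N ->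
  {in L1, forall v, #|nbr H v| = nu} -> (nu <= K)%N ->
  {in L1, forall v, (#|heavy_pairs L H Xi v| <= nu * (2 * kap))%N} ->
  exists H' L2, [/\ H' \subset H, L2 \subset L1, (#|L1| <= K * #|L2|)%N,
    {in L2, forall v, (k <= #|nbr H' v|)%N} &
    {in L2, forall v, heavy_pairs L H' Xi v = set0}].
Proof.
move=> k0 le_nu kap0 degL1 nuK heavyL1.
have nu0 : (0 < nu)%N by apply: leq_trans le_nu; rewrite !muln_gt0 k0 kap0.
have [p pE] : exists p : R, p = 16 * k%:R / nu%:R by exists (16 * k%:R / nu%:R).
have nuR : 0 < nu%:R :> R by rewrite ltr0n.
have kR : 1 <= k%:R :> R by rewrite ler1n.
have nup : nu%:R * p = 16 * k%:R by rewrite pE mulrC divfK // gt_eqF.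
have p0 : 0 <= p by rewrite pE divr_ge0 ?mulr_ge0 ?ler0n.
have kapp : kap%:R * p * (512 * k%:R) <= 1.
  rewrite -(ler_pM2l nuR) mulr1.
  rewrite (_ : _ * _ = (64 * 128 * (k * k * kap))%N%:R).
    by rewrite ler_nat.
  have -> : nu%:R * (kap%:R * p * (512 * k%:R)) = (nu%:R * p) * kap%:R * (512 * k%:R).
    by ring.
  by rewrite nup !natrM; ring.
have p1 : p <= 1.
  have kapR : 1 <= kap%:R :> R by rewrite ler1n.
  have le1 : 1 <= kap%:R * (512 * k%:R) :> R.
    by rewrite -[1]mulr1 ler_pM ?ler01 //; lra.
  by have := ler_wpM2l p0 le1; lra.
have p01 : 0 <= p <= 1 by rewrite p0 p1.
(* With Z sampled neighbours, each surviving heavy pair is charged Z, so [F v A] is Z times one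
   minus the number of surviving heavy pairs. *)
pose F v (A : {set G}) : R := \sum_(a in nbr H v) holds ([set a] \subset A) -
  \sum_(ab in heavy_pairs L H Xi v) \sum_(c in nbr H v) holds ([set ab.1; ab.2; c] \subset A).
have EF v : v \in L1 -> 14 * k%:R <= expect p (F v).
  move=> vL1; rewrite expectB !expect_sum.
  under eq_bigr do rewrite expect_subset cards1 expr1.
  rewrite sumr_const -[p *+ _]mulr_natl degL1 // nup.
  under eq_bigr do rewrite expect_sum.
  (* By [kapp], this expected penalty will be at most 2k. *)
  have le1 : \sum_(ab in heavy_pairs L H Xi v) \sum_(c in nbr H v)
      expect p (fun A => holds ([set ab.1; ab.2; c] \subset A)) <=
      (nu%:R * (2 * kap%:R)) * (2 * p ^+ 2 + nu%:R * p ^+ 3).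
    apply: le_trans (_ : \sum_(ab in heavy_pairs L H Xi v) (2 * p ^+ 2 + nu%:R * p ^+ 3) <= _).
      apply: ler_sum => -[a b] /=; rewrite inE => /and4P[_ _ /= ab _].
      under eq_bigr do rewrite expect_subset.
      by rewrite -(degL1 _ vL1) sum_pow3_le.
    rewrite sumr_const -[X in X <= _]mulr_natl ler_wpM2r ?addr_ge0 ?mulr_ge0 ?exprn_ge0 ?ler0n //.
    by rewrite -!natrM ler_nat heavyL1.
  have : (nu%:R * (2 * kap%:R)) * (2 * p ^+ 2 + nu%:R * p ^+ 3) =
      (nu%:R * p) * (4 * (kap%:R * p)) + 2 * (nu%:R * p) ^+ 2 * (kap%:R * p) by ring.
  rewrite nup.
  have kapp0 : 0 <= kap%:R * p by rewrite mulr_ge0 ?ler0n.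
  move: (kap%:R * p) kapp kapp0 => z zk z0 E.
  rewrite E in le1.
  have : 16 * k%:R * (4 * z) + 2 * (16 * k%:R) ^+ 2 * z <= 2 * k%:R.
    have kge0 : 0 <= k%:R :> R by lra.
    by have := ler_wpM2l kge0 zk; lra.
  lra.
have [A] := expect_attained p01 (fun A => \sum_(v in L1) F v A).
rewrite expect_sum => geA.
pose H' := H :&: A.
pose L2 := [set v in L1 | (k <= #|nbr H' v|)%N && (heavy_pairs L H' Xi v == set0)].
have leF v : v \in L1 -> F v A <= k%:R + K%:R * holds (v \in L2).
  move=> vL1; rewrite /F.
  have E1 : \sum_(a in nbr H v) holds ([set a] \subset A) = #|nbr H' v|%:R :> R.
    under eq_bigr do rewrite sub1set.
    rewrite sum_holds; congr (_%:R); apply: eq_card => x.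
    by rewrite !inE andbAC.
  rewrite E1.
  have heavy0 : 0 <= \sum_(ab in heavy_pairs L H Xi v) \sum_(c in nbr H v)
      holds ([set ab.1; ab.2; c] \subset A) :> R.
    by apply: sumr_ge0 => ab _; apply: sumr_ge0 => c _; rewrite /holds ler0n.
  have leK : #|nbr H' v|%:R <= K%:R :> R.
    rewrite ler_nat (leq_trans _ nuK) // -(degL1 _ vL1) subset_leq_card //.
    exact/nbrS/subsetIl.
  rewrite inE vL1 /=.
  have [h0|[[a b] abh]] := set_0Vmem (heavy_pairs L H' Xi v).
    rewrite h0 eqxx andbT; case: leqP => [_|ltk].
      by rewrite /holds /=; lra.
    have : #|nbr H' v|%:R <= k%:R :> R by rewrite ler_nat ltnW.
    rewrite /holds /=; lra.
  have -> : heavy_pairs L H' Xi v == set0 = false.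
    by apply/negP=> /eqP h0; rewrite h0 inE in abh.
  rewrite andbF mulr0 addr0.
  move: (abh); rewrite inE /= !in_nbr !inE => /and4P[/andP[/andP[aH aA] va] /andP[/andP[bH bA] vb] ab hab].
  have abH : (a, b) \in heavy_pairs L H Xi v by rewrite inE /= !in_nbr aH bH va vb ab.
  rewrite (bigD1 (a, b)) //=.
  have -> : \sum_(c in nbr H v) holds ([set a; b; c] \subset A) = #|nbr H' v|%:R :> R.
    rewrite -E1; apply: eq_bigr => c _; congr holds.
    by rewrite !subUset !sub1set aA bA.
  have : 0 <= \sum_(i in heavy_pairs L H Xi v | i != (a, b)) \sum_(c in nbr H v)
      holds ([set i.1; i.2; c] \subset A) :> R.
    by apply: sumr_ge0 => i _; apply: sumr_ge0 => c _; rewrite /holds ler0n.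
  lra.
exists H', L2; split; first exact: subsetIl.
- by apply/subsetP=> v; rewrite inE => /andP[].
- have : 14 * k%:R * #|L1|%:R <= k%:R * #|L1|%:R + K%:R * #|L2|%:R :> R.
    apply: le_trans (_ : \sum_(v in L1) (k%:R + K%:R * holds (v \in L2)) <= _); last first.
      rewrite big_split /= sumr_const -big_distrr /= sum_holds -[_ *+ _]mulr_natr lerD2l.
      by rewrite ler_wpM2l ?ler0n // ler_nat subset_leq_card ?subsetIr.
    apply: le_trans (ler_sum _ leF); apply: le_trans geA.
    by rewrite mulr_natr -sumr_const; apply: ler_sum.
  rewrite -!natrM -natrD ler_nat; nia.
- by move=> v; rewrite inE => /and3P[].
- by move=> v; rewrite inE => /and3P[_ _ /eqP].
Qed.

End Heavy.

(** * Alternating 4-cycles *)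

Section Alternating.
Variable G : sgraph.
Implicit Types (A B L H S T : {set G}) (x y v : G).

(** Adjacent corners differ because the graph is loopless, so only opposite corners are compared.
    Chords are allowed. *)
Definition cycle4 (x1 x2 x3 x4 : G) :=
  [&& adj x1 x2, adj x2 x3, adj x3 x4, adj x4 x1, x1 != x3 & x2 != x4].

Definition C4_free_on S := forall x1 x2 x3 x4,
  x1 \in S -> x2 \in S -> x3 \in S -> x4 \in S -> ~~ cycle4 x1 x2 x3 x4.

(** Division-free form of the conclusion of the theorem. *)
Definition has_dense_C4_free (k : nat) := exists S,
  [/\ C4_free_on S, 0 < #|S| & k * #|S| <= epairs S S].

Definition alternating L H := forall x1 x2 x3 x4,
  x1 \in L :|: H -> x2 \in L :|: H -> x3 \in L :|: H -> x4 \in L :|: H ->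
  cycle4 x1 x2 x3 x4 ->
  [&& x1 \in L, x3 \in L, x2 \in H & x4 \in H] ||
  [&& x2 \in L, x4 \in L, x1 \in H & x3 \in H].

Lemma alternatingS L H L' H' : [disjoint L & H] -> L' \subset L -> H' \subset H ->
  alternating L H -> alternating L' H'.
Proof.
move=> dLH L'L H'H alt x1 x2 x3 x4 i1 i2 i3 i4 c4.
have sub x : x \in L' :|: H' -> x \in L :|: H by apply: (subsetP (setUSS L'L H'H)).
have inL' x : x \in L' :|: H' -> x \in L -> x \in L'.
  by rewrite inE => /orP[//|/(subsetP H'H) xH xL]; have := disjointFr dLH xL; rewrite xH.
have inH' x : x \in L' :|: H' -> x \in H -> x \in H'.
  by rewrite inE => /orP[/(subsetP L'L) xL xH|//]; have := disjointFr dLH xL; rewrite xH.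
have := alt _ _ _ _ (sub _ i1) (sub _ i2) (sub _ i3) (sub _ i4) c4.
by case/orP=> /and4P[h1 h2 h3 h4]; rewrite ?(inL' _ _ h1) ?(inL' _ _ h2) ?(inH' _ _ h3) ?(inH' _ _ h4) ?orbT.
Qed.

(** Charge each u sharing two neighbours with v to such an ordered pair. There are at most K^2
    pairs, and each is light, so it has fewer than [Xi] common neighbours in [L]. *)
Lemma card_conflicts L H (Xi K : nat) v : #|nbr H v| <= K -> heavy_pairs L H Xi v = set0 ->
  #|[set u in L | (u != v) && (1 < #|nbr H v :&: nbr H u|)]| <= K ^ 2 * Xi.
Proof.
move=> leK light; pose N := nbr H v.
pose pairs := [set ab : G * G | [&& ab.1 \in N, ab.2 \in N & ab.1 != ab.2]].
have cpairs : #|pairs| <= K ^ 2.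
  rewrite (leq_trans (subset_leq_card (_ : pairs \subset setX N N))) //.
    by apply/subsetP=> ab; rewrite !inE => /and3P[-> ->].
  by rewrite cardsX expnS expn1 leq_mul.
apply: leq_trans (_ : \sum_(ab in pairs) codegree L ab.1 ab.2 <= _); last first.
  apply: leq_trans (_ : \sum_(ab in pairs) Xi <= _); last first.
    by rewrite sum_nat_const leq_mul2r cpairs orbT.
  apply: leq_sum => ab; rewrite inE => /and3P[aN bN ab12].
  rewrite leqNgt; apply/negP=> gtXi.
  have : ab \in heavy_pairs L H Xi v by rewrite inE aN bN ab12 ltnW.
  by rewrite light inE.
rewrite -sum1_card.
apply: leq_trans (_ : \sum_(u in L | (u != v) && (1 < #|nbr H v :&: nbr H u|))
   \sum_(ab in pairs) ((u \in nbr L ab.1) && (u \in nbr L ab.2)) <= _).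
  rewrite big_mkcond [X in _ <= X]big_mkcond; apply: leq_sum => u _.
  rewrite inE; case: ifP => // /and3P[uL _ /card_gt1P[a [b [+ + ab]]]].
  rewrite !in_setI !in_nbr => /andP[/andP[aH va] /andP[_ ua]] /andP[/andP[bH vb] /andP[_ ub]].
  have abp : (a, b) \in pairs by rewrite inE !in_nbr aH va bH vb ab.
  by rewrite (bigD1 (a, b)) //= !in_nbr uL adj_sym ua adj_sym ub.
rewrite exchange_big /=; apply: leq_sum => ab _.
rewrite /codegree -sum1_card big_mkcond [X in _ <= X]big_mkcond /=; apply: leq_sum => u _.
by rewrite !inE; case: (u \in L); case: (_ && (1 < _)); case: (adj ab.1 u); case: (adj ab.2 u).
Qed.

(** Choose [I] greedily in [L2] with no two vertices sharing two neighbours in H'. This excludes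
    alternating cycles, and |H'| <= |I| makes the average degree of the union at least k. *)
Lemma light_dense_C4_free (L H L2 H' : {set G}) (Xi K k : nat) :
  [disjoint L & H] -> alternating L H -> L2 \subset L -> H' \subset H ->
  {in L2, forall v, heavy_pairs L H' Xi v = set0} ->
  {in L2, forall v, k <= #|nbr H' v| <= K} ->
  0 < #|L2| -> (K ^ 2 * Xi).+1 * #|H'| <= #|L2| -> has_dense_C4_free k.
Proof.
move=> dLH alt L2L H'H light deg L20 cH'.
pose r v u := (u != v) && (1 < #|nbr H' v :&: nbr H' u|).
have [|U UL2 /set0Pn[v vU]|I [IL2 Iind cI]] := @greedy_independent G r (K ^ 2 * Xi) L2.
- by move=> u v; rewrite /r eq_sym setIC.
- exists v => //; have vL2 := subsetP UL2 _ vU.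
  have /andP[_ degv] := deg _ vL2.
  apply: leq_trans (card_conflicts degv (light _ vL2)).
  apply/subset_leq_card/subsetP=> u; rewrite !inE => /andP[uU ruv].
  by rewrite (subsetP L2L _ (subsetP UL2 _ uU)).
have IL := subset_trans IL2 L2L.
have dIH' : [disjoint I & H'] by apply: disjointWl IL (disjointWr H'H dLH).
have I0 : 0 < #|I| by rewrite lt0n; apply/eqP=> cI0; rewrite cI0 muln0 in cI; lia.
have leH' : #|H'| <= #|I|.
  by rewrite -(leq_pmul2l (ltn0Sn (K ^ 2 * Xi))) (leq_trans cH').
exists (I :|: H'); split.
- have altI := alternatingS dLH IL H'H alt.
  have conflict x1 x2 x3 x4 : x1 \in I -> x3 \in I -> x2 \in H' -> x4 \in H' ->
      cycle4 x1 x2 x3 x4 -> False.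
    move=> i1 i3 h2 h4 /and5P[a12 a23 a34 a41 /andP[n13 n24]].
    have := Iind _ _ i1 i3 n13; rewrite /r eq_sym n13 /= => /negP; apply.
    apply/card_gt1P; exists x2, x4; split=> //; rewrite !inE ?h2 ?h4 /=.
      by rewrite a12 adj_sym a23.
    by rewrite a34 adj_sym a41.
  move=> x1 x2 x3 x4 i1 i2 i3 i4; apply/negP=> c4.
  case/orP: (altI _ _ _ _ i1 i2 i3 i4 c4) => /and4P[h1 h2 h3 h4].
    exact: conflict c4.
  apply: (conflict x2 x3 x4 x1) => //; move: c4; rewrite /cycle4.
  by case/and5P=> -> -> -> -> /andP[n13 ->]; rewrite eq_sym n13.
- by rewrite cardsU disjoint_setI0 // cards0; lia.
have : k * #|I| <= epairs I H'.
  by apply: epairs_geq => v /(subsetP IL2)/deg/andP[].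
rewrite epairs_disjointU // cardsU disjoint_setI0 // cards0; nia.
Qed.

End Alternating.

Lemma large_fibre (T : finType) (A : {set T}) (f : T -> nat) (K : nat) :
  {in A, forall x, f x <= K} -> 0 < #|A| ->
  exists2 n, n <= K & #|A| <= K.+1 * #|[set x in A | f x == n]|.
Proof.
move=> leK A0.
have [/existsP[i hi]|/existsPn low] :=
  boolP [exists i : 'I_K.+1, #|A| <= K.+1 * #|[set x in A | f x == i]|].
  by exists i; rewrite // -ltnS.
have : \sum_(i < K.+1) #|[set x in A | f x == i]| = #|A|.
  rewrite -[RHS]sum1_card (partition_big (fun x => inord (f x) : 'I_K.+1) predT) //=.
  apply: eq_bigr => i _; rewrite -sum1_card; apply: eq_bigl => x; rewrite inE.
  apply: andb_id2l => xA; rewrite -val_eqE /= inordK // ltnS; exact: leK.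
have : \sum_(i < K.+1) K.+1 * #|[set x in A | f x == i]| <= \sum_(i < K.+1) #|A|.-1.
  by apply: leq_sum => i _; have := low i; rewrite -ltnNge; lia.
by rewrite -big_distrr sum_nat_const card_ord /= leq_mul2l /= => + E; rewrite E; lia.
Qed.

(** * Induction on one side of the forbidden biclique *)

Section FindDense.
Variable G : sgraph.
Implicit Types (A B L H S T : {set G}) (x y v : G).
Variables (k s K : nat).
Hypotheses (k0 : 0 < k) (s0 : 0 < s) (K0 : 0 < K).

(** Degree thresholds for the two sides at stage [j]. The factor [64 * 128 * (k * k)] is the one
    required by [thin_out_heavy]; the factor [16 * K ^ 7] keeps L larger than H by enough after all
    losses of one stage. *)
Definition side_degree (j : nat) := (64 * 128 * (k * k)) ^ j * 2.
Definition pair_degree (j : nat) := (16 * K ^ 7) ^ j * s.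

Definition heavy_with L H (Xi : nat) x := [set y in H | (y != x) && (Xi <= codegree L x y)].

Lemma card_heavy_pairs L H (Xi : nat) v :
  #|heavy_pairs L H Xi v| = \sum_(x in nbr H v) #|nbr (heavy_with L H Xi x) v|.
Proof.
rewrite -sum1_card.
under [RHS]eq_bigr do rewrite -sum1_card.
rewrite pair_big_dep /=; apply: eq_bigl => -[x y]; rewrite !inE /=.
by rewrite [y == x]eq_sym; case: (x \in H); case: (adj v x); case: (y \in H);
  case: (x == y); case: (adj v y); case: (_ <= _).
Qed.

(** Induction on [j], the size of the subsets of [H] having fewer than [s] common neighbours in [L].
    The last hypothesis is the one that [min_degree_pair] turns into minimum degrees on both
    sides. *)
Lemma find_dense_C4_free j L H : [disjoint L & H] -> alternating L H ->
  {in L, forall v, #|nbr H v| <= K} ->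
  (forall T, T \subset H -> #|T| = j -> #|common L T| < s) ->
  side_degree j * #|L| + pair_degree j * #|H| < epairs L H ->
  has_dense_C4_free G k.
Proof.
elim: j L H => [|j IH] L H dLH alt degK few.
  (* For j = 0 the whole of [L] is the common neighbourhood of the empty set, so |L| < s and there
     are too few pairs. *)
  have := few set0 (sub0set _) (cards0 _).
  have -> : common L set0 = L.
    by apply/setP=> x; rewrite inE andb_idr // => _; apply/forall_inP=> y; rewrite inE.
  have : epairs L H <= #|L| * #|H|.
    by rewrite mulnC; apply: epairs_leq => v _; apply/subset_leq_card/nbr_sub.
  rewrite /pair_degree expn0 mul1n; nia.
move=> /min_degree_pair[L' [H' [L'L H'H L'0 degL degH]]].
have {}few T : T \subset H' -> #|T| = j.+1 -> #|common L' T| < s.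
  move=> TH' cT; apply: leq_ltn_trans (few T (subset_trans TH' H'H) cT).
  apply/subset_leq_card/subsetP=> y; rewrite !inE => /andP[yL' ->].
  by rewrite (subsetP L'L).
have {}alt := alternatingS dLH L'L H'H alt.
have {}dLH : [disjoint L' & H'] by apply: disjointWl L'L (disjointWr H'H dLH).
have {}degK : {in L', forall v, #|nbr H' v| <= K}.
  move=> v vL'; apply: leq_trans (degK v (subsetP L'L _ vL')).
  exact/subset_leq_card/nbrS.
move: L' H' {L'L H'H} L'0 degL degH few alt dLH degK => {}L {}H L0 degL degH few alt dLH degK.
set kap := side_degree j; set X := pair_degree j.
have kapS : side_degree j.+1 = 64 * 128 * (k * k * kap).
  by rewrite /side_degree expnS /kap /side_degree -!mulnA.
have XS : pair_degree j.+1 = 16 * K ^ 7 * X by rewrite /X /pair_degree expnS mulnA.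
have kap2 : 1 < kap.
  by rewrite /kap /side_degree; have := expn_gt0 (64 * 128 * (k * k)) j; nia.
have X0 : 0 < X.
  by rewrite /X /pair_degree muln_gt0 expn_gt0 muln_gt0 expn_gt0 K0 s0.
rewrite kapS in degL; rewrite XS in degH.
(* Large enough that the heavy partners of the chosen x satisfy X|H2| <= |L2|, and small enough that
   K^2 Xi + 1 <= 4 K^4 X in the light case. *)
pose Xi := 2 * K ^ 2 * X.
have eLH : epairs L H <= K * #|L| by apply: epairs_leq.
pose rich x v := 2 * kap <= #|nbr (heavy_with L H Xi x) v|.
pose Lr := [set v in L | [exists x in nbr H v, rich x v]].
have LrL : Lr \subset L by apply/subsetP=> v; rewrite inE => /andP[].
have [manyrich|fewrich] := leqP #|L| (2 * #|Lr|).
(* There are at least |L|/2 rich pairs (x, v) but at most K|L| edges, so some x is rich for a 1/(2K)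
   fraction of its neighbours. *)
- have [x xH richx] : exists2 x, x \in H &
      #|nbr L x| <= 2 * K * #|[set v in nbr L x | rich x v]|.
    have [/exists_inP[x xH hx]|/exists_inPn low] := boolP
      [exists x in H, #|nbr L x| <= 2 * K * #|[set v in nbr L x | rich x v]|].
      by exists x.
    have le1 : \sum_(x in H) (2 * K * #|[set v in nbr L x | rich x v]| + 1) <= epairs H L.
      by apply: leq_sum => x /low; rewrite -ltnNge addn1.
    rewrite big_split /= -big_distrr /= sum1_card in le1.
    have le2 : #|Lr| <= \sum_(x in H) #|[set v in nbr L x | rich x v]|.
      rewrite -sum1_card.
      under [X in _ <= X]eq_bigr do rewrite -sum1_card big_mkcond.
      rewrite exchange_big /= big_mkcond; apply: leq_sum => v _.
      case: ifP => //; rewrite inE => /andP[vL /exists_inP[x]].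
      rewrite in_nbr => /andP[xH vx] rx; rewrite (bigD1 x) //=.
      by rewrite !inE vL adj_sym vx rx.
    have H0 : 0 < #|H|.
      have [v vL] := card_gt0P L0; have := degL v vL.
      have := subset_leq_card (nbr_sub H v); nia.
    rewrite epairsC in le1; nia.
  pose L2 := [set v in nbr L x | rich x v].
  have L2L : L2 \subset L by apply/subsetP=> v; rewrite inE => /andP[/(subsetP (nbr_sub _ _))].
  pose H2 := heavy_with L H Xi x.
  have H2H : H2 \subset H by apply/subsetP=> y; rewrite inE => /andP[].
  have cH2 : #|H2| * Xi <= K * #|nbr L x|.
    have e1 : Xi * #|H2| <= epairs H2 (nbr L x).
      apply: epairs_geq => y; rewrite inE => /and3P[yH _]; move/leq_trans; apply.
      apply/subset_leq_card/subsetP=> v; rewrite !inE.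
      by move=> /andP[/andP[-> ->] /andP[_ ->]].
    rewrite mulnC (leq_trans e1) // epairsC; apply: epairs_leq => v.
    move=> /(subsetP (nbr_sub _ _))/degK; apply: leq_trans.
    exact/subset_leq_card/nbrS.
  have L20 : 0 < #|L2| by have := degH x xH; have := expn_gt0 K 7; rewrite -/L2 in richx; nia.
  apply: (IH L2 H2).
  + exact: disjointWl L2L (disjointWr H2H dLH).
  + exact: alternatingS dLH L2L H2H alt.
  + move=> v vL2; apply: leq_trans (degK v (subsetP L2L _ vL2)).
    exact/subset_leq_card/nbrS.
  (* All of [L2] is adjacent to x and x is not in [H2], so adding x to [T] gains one vertex without
     losing common neighbours. *)
  + move=> T TH2 cT; apply: leq_ltn_trans (few (x |: T) _ _).
    * apply/subset_leq_card/subsetP=> v; rewrite [v \in common _ _]inE => /andP[vL2 /forall_inP adjT].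
      rewrite inE (subsetP L2L _ vL2); apply/forall_inP=> y; rewrite !inE.
      case/orP=> [/eqP->|]; last exact: adjT.
      by move: vL2; rewrite !inE => /andP[/andP[]].
    * by rewrite subUset sub1set xH (subset_trans TH2 H2H).
    * rewrite cardsU1 cT; case: (boolP (x \in T)) => // /(subsetP TH2).
      by rewrite !inE eqxx andbF.
  (* Half of 2 kap|L2| covers the [L2] term; the other half exceeds X|H2|, strictly because kap >
     1. *)
  + have : 2 * kap * #|L2| <= epairs L2 H2.
      by apply: epairs_geq => v; rewrite inE => /andP[].
    apply: leq_trans; rewrite -/kap -/X.
    rewrite -/L2 in richx.
    have : X * #|H2| * K ^ 2 <= #|L2| * K ^ 2.
      move: cH2 richx; rewrite /Xi expnS expn1; nia.
    rewrite leq_pmul2r ?expn_gt0 ?K0 //; nia.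
pose Ls := L :\: Lr.
have cLs : #|L| < 2 * #|Ls|.
  by have := cardsID Lr L; rewrite (setIidPr LrL) -/Ls; lia.
have LsL : Ls \subset L by apply: subsetDl.
(* Fix one common degree nu, since the sampling rate in [thin_out_heavy] depends on it. *)
have [||nu nuK cL1] := @large_fibre G Ls (fun v => #|nbr H v|) K.
- by move=> v /(subsetP LsL)/degK.
- lia.
set L1 := [set v in Ls | _] in cL1.
have L1Ls : L1 \subset Ls by apply/subsetP=> v; rewrite inE => /andP[].
have L1L := subset_trans L1Ls LsL.
have degL1 : {in L1, forall v, #|nbr H v| = nu} by move=> v; rewrite inE => /andP[_ /eqP].
have L10 : 0 < #|L1| by nia.
have [v1 v1L1] := card_gt0P L10.
have le_nu : 64 * 128 * (k * k * kap) <= nu.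
  by rewrite -(degL1 _ v1L1) degL // (subsetP L1L).
have [|H' [L2 [H'H L2L1 cL2 kL2 light]]] :=
  thin_out_heavy rat (L := L) (Xi := Xi) k0 le_nu (ltnW kap2) degL1 nuK.
  move=> v vL1; rewrite card_heavy_pairs -(degL1 _ vL1) -sum_nat_const.
  apply: leq_sum => x xv; have /setDP[vL nLr] := subsetP L1Ls _ vL1.
  rewrite leqNgt; apply/negP=> /ltnW rx; case/negP: nLr; rewrite inE vL.
  by apply/exists_inP; exists x.
have L20 : 0 < #|L2| by move: cL2; case: #|L2| => //; rewrite muln0; lia.
apply: (@light_dense_C4_free G L H L2 H' Xi K k) => //.
- exact: subset_trans L2L1 L1L.
- move=> v vL2; rewrite kL2 //=.
  apply: leq_trans (degK v (subsetP L1L _ (subsetP L2L1 _ vL2))).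
  exact/subset_leq_card/nbrS.
(* The losses are K from edge counting, 4K from passing to [L1] and K from thinning; what remains is
   4 K^4 X |H'| <= |L2|. *)
have e1 : 16 * K ^ 7 * X * #|H'| <= K * #|L|.
  apply: leq_trans eLH; rewrite epairsC; apply: leq_trans (epairsS H'H (subxx L)).
  by apply: epairs_geq => x /(subsetP H'H)/degH.
have K1L1 : K.+1 * #|L1| <= 2 * K * #|L1| by rewrite leq_mul2r; apply/orP; right; lia.
have cL : #|L| <= 4 * K * #|L1| by lia.
have e2 : 4 * K ^ 3 * (4 * K ^ 4 * X * #|H'|) <= 4 * K ^ 3 * #|L2|.
  have -> : 4 * K ^ 3 * (4 * K ^ 4 * X * #|H'|) = 16 * K ^ 7 * X * #|H'|.
    by rewrite !expnS expn0; lia.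
  apply: leq_trans e1 _; apply: leq_trans (leq_mul (leqnn K) cL) _.
  have -> : 4 * K ^ 3 * #|L2| = 4 * K * K * (K * #|L2|) by rewrite !expnS expn0; lia.
  have -> : K * (4 * K * #|L1|) = 4 * K * K * #|L1| by lia.
  by rewrite leq_mul2l cL2 orbT.
rewrite leq_pmul2l ?muln_gt0 ?expn_gt0 ?K0 // in e2.
apply: leq_trans e2; rewrite leq_mul2r; apply/orP; right.
have : 0 < K ^ 4 * X by rewrite muln_gt0 expn_gt0 K0.
rewrite /Xi !expnS expn0; nia.
Qed.

End FindDense.

(** * Sampling *)

Section Sampling.
Variables (R : realFieldType) (G : sgraph) (out : G -> {set G}).
Hypothesis out_adj : forall u x, x \in out u -> adj u x.
Implicit Types (A S : {set G}) (t : G * G * G) (E : {set G * G}).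

(* The 4-cycles u x y z in which every edge except yz is directed away from u. *)
Definition sourced_cycles u : {set G * G * G} :=
  [set t | let: (x, y, z) := t in
    [&& x \in out u, y \in out x, z \in out u, adj y z, x != z & y != u]].

Definition vertices t : {set G} := let: (x, y, z) := t in [set x; y; z].

(** The random set is cleaned by discarding each vertex that is the source of a fully sampled
    cycle. *)
Definition survives A u := (u \in A) && [forall t in sourced_cycles u, ~~ (vertices t \subset A)].

(** Choose x in at most [D] ways; then yz is an edge between [out x] and [out u], and the edge bound
    for biclique-free graphs saves a factor [g]. *)
Lemma card_sourced_cycles s g D u : (0 < s)%N -> (0 < g)%N -> biclique_free G s ->
  (forall v, (#|out v| <= D)%N) -> (2 * g * ((8 * g) ^ s * s) <= D)%N ->
  (g * #|sourced_cycles u| <= D ^ 3)%N.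
Proof.
move=> s0 g0 fr leD geD.
have le1 : (#|sourced_cycles u| <= \sum_(x in out u) epairs (out x) (out u))%N.
  pose f (t : G * G * G) := (t.1.1, (t.1.2, t.2)).
  have injf : injective f by move=> [[x y] z] [[x' y'] z'] [-> -> ->].
  rewrite -(card_imset _ injf) /=.
  have -> : (\sum_(x in out u) epairs (out x) (out u) =
      #|[set q : G * (G * G) | [&& q.1 \in out u, q.2.1 \in out q.1 & q.2.2 \in nbr (out u) q.2.1]]|)%N.
    rewrite -sum1_card /epairs.
    under eq_bigr do under eq_bigr do rewrite -sum1_card.
    under eq_bigr do rewrite pair_big_dep /=.
    by rewrite pair_big_dep /=; apply: eq_bigl => -[x [y z]]; rewrite /= !inE.
  apply/subset_leq_card/subsetP=> q /imsetP[[[x y] z]]; rewrite inE => h ->.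
  by move: h; rewrite inE /= in_nbr => /and5P[-> -> -> -> _].
apply: leq_trans (_ : (g * (\sum_(x in out u) epairs (out x) (out u)) <= _)%N).
  by rewrite leq_mul2l le1 orbT.
rewrite big_distrr /= expnS.
apply: leq_trans (_ : (\sum_(x in out u) D ^ 2 <= _)%N); last first.
  by rewrite sum_nat_const leq_mul2r leD orbT.
by apply: leq_sum => x _; apply: (biclique_free_epairs s0).
Qed.

Local Open Scope ring_scope.
Variables (p c : R).
Hypothesis p01 : 0 <= p <= 1.
Hypothesis cyc_c : forall u, #|sourced_cycles u|%:R <= c.

(** The source and the three vertices of t are distinct, and [a] is a fifth vertex unless it lies on
    t. *)
Lemma pow_sourced_cycle v a t : t \in sourced_cycles v -> v != a ->
  p ^+ #|[set v; a] :|: vertices t| <= p ^+ 5 + p ^+ 4 * holds (a \in vertices t).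
Proof.
have /andP[p0 p1] := p01.
case: t => [[x y] z]; rewrite inE => /and5P[vx xy vz yz /andP[xz yv]] va.
rewrite /vertices.
have c4 : #|v |: [set x; y; z]| = 4%N.
  have nxy : x != y by apply: contraTneq (out_adj xy) => ->; rewrite adj_irrefl.
  have nvx : v != x by apply: contraTneq (out_adj vx) => ->; rewrite adj_irrefl.
  have nvz : v != z by apply: contraTneq (out_adj vz) => ->; rewrite adj_irrefl.
  have nyz : y != z by apply: contraTneq yz => ->; rewrite adj_irrefl.
  rewrite -setUA !cardsU1 cards1 !inE.
  by rewrite !negb_or nvx nvz [v == y]eq_sym yv nxy xz nyz.
have -> : [set v; a] :|: [set x; y; z] = a |: (v |: [set x; y; z]).
  by rewrite [[set v; a]]setUC -setUA.
rewrite cardsU1 c4 in_setU1 eq_sym (negPf va) /=.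
case: (a \in _) => /=; first by rewrite mulr1 lerDr exprn_ge0.
by rewrite mulr0 addr0.
Qed.

(** For fixed v and t, at most three second endpoints lie on t; these rare coincidences give the
    term with p^4. *)
Lemma sum_sourced_cycles S E : E \subset setX S S -> {in E, forall e, e.1 != e.2} ->
  \sum_(e in E) \sum_(t in sourced_cycles e.1) p ^+ #|[set e.1; e.2] :|: vertices t|
    <= #|E|%:R * c * p ^+ 5 + 3 * #|S|%:R * c * p ^+ 4.
Proof.
move=> ES irr; have /andP[p0 p1] := p01.
apply: le_trans (_ : \sum_(e in E) (\sum_(t in sourced_cycles e.1) p ^+ 5 +
   \sum_(t in sourced_cycles e.1) p ^+ 4 * holds (e.2 \in vertices t)) <= _).
  apply: ler_sum => e eE; rewrite -big_split; apply: ler_sum => t tv.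
  exact: pow_sourced_cycle tv (irr _ eE).
rewrite big_split /=; apply: lerD.
  rewrite -mulrA mulr_natl -sumr_const; apply: ler_sum => e _.
  by rewrite sumr_const -[X in X <= _]mulr_natl ler_wpM2r ?exprn_ge0.
apply: le_trans (_ : \sum_(v in S) \sum_(a : G) \sum_(t in sourced_cycles v)
    p ^+ 4 * holds (a \in vertices t) <= _).
  rewrite [leRHS]pair_big_dep /= big_mkcond [leRHS]big_mkcond; apply: ler_sum => e _ /=.
  rewrite andbT.
  case: ifP => [/(subsetP ES)|_]; first by rewrite inE => /andP[-> _].
  by case: ifP => // _; apply: sumr_ge0 => t _; rewrite mulr_ge0 ?exprn_ge0 ?/holds ?ler0n.
rewrite (_ : 3 * #|S|%:R * c * p ^+ 4 = #|S|%:R * (c * (3 * p ^+ 4))); last by ring.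
rewrite mulr_natl -sumr_const; apply: ler_sum => v _.
rewrite exchange_big /=.
apply: le_trans (_ : \sum_(t in sourced_cycles v) 3 * p ^+ 4 <= _); last first.
  rewrite sumr_const -[X in X <= _]mulr_natl ler_wpM2r //.
  by rewrite mulr_ge0 ?exprn_ge0.
apply: ler_sum => -[[x y] z] _; rewrite -big_distrr /= mulrC ler_wpM2r ?exprn_ge0 //.
have -> : \sum_(a : G) holds (a \in [set x; y; z]) = #|[set x; y; z]|%:R :> R.
  have := @sum_holds R _ setT [set x; y; z]; rewrite setTI => <-.
  by apply: eq_bigl => a; rewrite inE.
rewrite ler_nat (leq_trans (leq_card_setU _ _)) //.
by rewrite cards1 addn1 ltnS cards2; case: eqP.
Qed.

(** Union bound: a sampled pair fails to survive only if a cycle sourced at one of its ends is fully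
    sampled. *)
Lemma expect_survivors S E : E \subset setX S S -> {in E, forall e, e.1 != e.2} ->
  #|E|%:R * p ^+ 2 - 2 * (#|E|%:R * c * p ^+ 5 + 3 * #|S|%:R * c * p ^+ 4)
   <= expect p (fun A => \sum_(e in E) holds (survives A e.1 && survives A e.2)).
Proof.
move=> ES irr; have /andP[p0 p1] := p01.
pose cyc e u := \sum_(t in sourced_cycles u) p ^+ #|[set e.1; e.2] :|: vertices t|.
pose F e A : R := holds ([set e.1; e.2] \subset A)
  - \sum_(t in sourced_cycles e.1) holds ([set e.1; e.2] :|: vertices t \subset A)
  - \sum_(t in sourced_cycles e.2) holds ([set e.1; e.2] :|: vertices t \subset A).
have nonneg e u A : 0 <= \sum_(t in sourced_cycles u) holds ([set e.1; e.2] :|: vertices t \subset A) :> R.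
  by apply: sumr_ge0 => t _; rewrite /holds ler0n.
have leF e A : F e A <= holds (survives A e.1 && survives A e.2).
  rewrite /F /survives; have := nonneg e e.1 A; have := nonneg e e.2 A.
  have [eA|] := boolP ([set e.1; e.2] \subset A); last first.
    have -> : holds false = 0 :> R by [].
    by move=> _ h1 h2; apply: le_trans (_ : 0 <= _); [lra|rewrite /holds ler0n].
  have [e1A e2A] : e.1 \in A /\ e.2 \in A.
    by move: eA; rewrite subUset !sub1set => /andP[].
  rewrite e1A e2A /=.
  have hit u : ~~ [forall t in sourced_cycles u, ~~ (vertices t \subset A)] ->
      1 <= \sum_(t in sourced_cycles u) holds ([set e.1; e.2] :|: vertices t \subset A) :> R.
    rewrite negb_forall => /existsP[t]; rewrite negb_imply negbK => /andP[tu tA].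
    rewrite (bigD1 t) //= subUset eA tA /holds /= lerDl.
    by apply: sumr_ge0 => i _; rewrite ler0n.
  have holds1 : holds true = 1 :> R by [].
  have holds0 : holds false = 0 :> R by [].
  have [_|/hit h1] := boolP [forall t in sourced_cycles e.1, ~~ (vertices t \subset A)].
    have [_|/hit h2] := boolP [forall t in sourced_cycles e.2, ~~ (vertices t \subset A)].
      by rewrite /= holds1; lra.
    by rewrite /= holds1 holds0; lra.
  by move=> h2 _; rewrite /= holds1 holds0; lra.
apply: le_trans (_ : expect p (fun A => \sum_(e in E) F e A) <= _); last first.
  by apply: expect_le => // A; apply: ler_sum => e _.
have -> : expect p (fun A => \sum_(e in E) F e A) =
    \sum_(e in E) (p ^+ 2 - cyc e e.1 - cyc e e.2).
  rewrite expect_sum; apply: eq_bigr => e eE; rewrite !expectB !expect_sum expect_subset.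
  rewrite cards2 irr // /cyc; congr (_ - _ - _);
    by apply: eq_bigr => t _; rewrite expect_subset.
rewrite !big_split /= !sumrN sumr_const -[_ *+ _]mulr_natl.
have h1 := sum_sourced_cycles ES irr.
have h2 : \sum_(e in E) cyc e e.2 <= #|E|%:R * c * p ^+ 5 + 3 * #|S|%:R * c * p ^+ 4.
  (* Reversing all pairs reduces cycles sourced at the second endpoint to the bound already proved
     for the first. *)
  pose sw (e : G * G) := (e.2, e.1).
  have swK : involutive sw by case.
  have <- : #|sw @: E| = #|E| by rewrite card_imset //; apply: inv_inj.
  have -> : \sum_(e in E) cyc e e.2 = \sum_(e in sw @: E) cyc e e.1.
    rewrite big_imset /=; last by move=> ? ? _ _; apply: inv_inj.
    by apply: eq_bigr => e _; rewrite /cyc; apply: eq_bigr => t _; rewrite [_ |: [set _]]setUC.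
  apply: sum_sourced_cycles.
    apply/subsetP=> _ /imsetP[e /(subsetP ES) + ->]; rewrite !inE /=.
    by rewrite andbC.
  by move=> _ /imsetP[e /irr + ->]; rewrite eq_sym.
by rewrite -/(cyc _ _) in h1; lra.
Qed.

End Sampling.

Lemma card_edge_set (G : sgraph) (L H : {set G}) :
  #|[set e : G * G | (e.1 \in L) && (e.2 \in nbr H e.1)]| = epairs L H.
Proof.
rewrite -sum1_card /epairs.
under [RHS]eq_bigr do rewrite -sum1_card.
by rewrite pair_big_dep /=; apply: eq_bigl => -[v a]; rewrite inE.
Qed.

(** * Sampling with bounded out-degrees *)

Section BoundedOut.
Variables (R : realFieldType) (G : sgraph).
Variables (s g D P d n kap : nat).
Hypotheses (s0 : 0 < s) (g0 : 0 < g) (d0 : 0 < d) (kap0 : 0 < kap) (Pd : P <= d).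
Hypothesis fr : biclique_free G s.
Hypothesis geD : 2 * g * ((8 * g) ^ s * s) <= D.
Hypothesis geg : 16 * (P * D) ^ 3 <= g * d ^ 3.

Local Open Scope ring_scope.
Let p : R := P%:R / d%:R.

Lemma ratio_bounds : 0 <= p <= 1.
Proof.
rewrite /p divr_ge0 ?ler0n //=.
by rewrite ler_pdivrMr ?ltr0n // mul1r ler_nat.
Qed.

(** With c = D^3/g, hypothesis [geg] says 16 c p^3 <= 1, so cycles destroy only a small part of the
    main term. The summand with p^2/8 is slack, spent later on vertices of too large sampled
    degree. *)
Lemma expect_survivors_ge (out : G -> {set G}) (S : {set G}) (E : {set G * G}) :
  (forall u x, x \in out u -> adj u x) -> (forall u, (#|out u| <= D)%N) ->
  E \subset setX S S -> {in E, forall e, e.1 != e.2} ->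
  (#|S| <= n)%N -> (8 * kap * d * n <= P * #|E|)%N ->
  5 * kap%:R * n%:R * p + #|E|%:R * p ^+ 2 / 8 <=
   expect p (fun A => \sum_(e in E) holds (survives out A e.1 && survives out A e.2)).
Proof.
move=> out_adj outD ES irr Sn geE; have /andP[p0 p1] := ratio_bounds.
pose c : R := D%:R ^+ 3 / g%:R.
have gR : 0 < g%:R :> R by rewrite ltr0n.
have dR : 0 < d%:R :> R by rewrite ltr0n.
have c0 : 0 <= c by rewrite /c divr_ge0 ?exprn_ge0 ?ler0n.
have cyc_c u : #|sourced_cycles out u|%:R <= c.
  rewrite /c ler_pdivlMr // mulrC -natrX -natrM ler_nat.
  exact: (card_sourced_cycles u s0 g0 fr outD geD).
apply: le_trans (expect_survivors out_adj ratio_bounds cyc_c ES irr).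
have th : 16 * (c * p ^+ 3) <= 1.
  have -> : 16 * (c * p ^+ 3) = (16 * (P%:R * D%:R) ^+ 3) / (g%:R * d%:R ^+ 3).
    by rewrite /c /p; field; rewrite !gt_eqF.
  rewrite ler_pdivrMr ?mulr_gt0 ?exprn_gt0 // mul1r.
  by move: geg; rewrite -(ler_nat R) !(natrM, natrX).
have th0 : 0 <= c * p ^+ 3 by rewrite mulr_ge0 ?exprn_ge0.
have eE : 8 * kap%:R * n%:R <= #|E|%:R * p.
  rewrite /p mulrA ler_pdivlMr //.
  by move: geE; rewrite -(ler_nat R) !natrM; lra.
have kR : 1 <= kap%:R :> R by rewrite ler1n.
have SR : #|S|%:R <= n%:R :> R by rewrite ler_nat.
have S0 : 0 <= #|S|%:R :> R by rewrite ler0n.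
have n0 : 0 <= n%:R :> R by rewrite ler0n.
have e0 : 0 <= #|E|%:R * p by rewrite mulr_ge0 ?ler0n.
have -> : #|E|%:R * p ^+ 2 - 2 * (#|E|%:R * c * p ^+ 5 + 3 * #|S|%:R * c * p ^+ 4) =
   p * (#|E|%:R * p - 2 * (#|E|%:R * p * (c * p ^+ 3)) - 6 * #|S|%:R * (c * p ^+ 3)) by ring.
have -> : 5 * kap%:R * n%:R * p + #|E|%:R * p ^+ 2 / 8 =
   p * (5 * kap%:R * n%:R + #|E|%:R * p / 8) by field.
apply: ler_wpM2l => //.
move: (#|E|%:R * p) eE e0 (c * p ^+ 3) th th0 => e eE e0 t th th0.
have h1 : e * (16 * t) <= e * 1 by apply: ler_wpM2l.
have h2 : #|S|%:R * (16 * t) <= #|S|%:R * 1 by apply: ler_wpM2l.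
have h3 : 1 * n%:R <= kap%:R * n%:R :> R by apply: ler_wpM2r.
lra.
Qed.

(** Taking full neighbourhoods in [S] as out-sets makes each vertex of a 4-cycle a source, so the
    survivors induce a [C4]-free graph. *)
Lemma regular_dense_C4_free (S : {set G}) :
  {in S, forall v, (#|nbr S v| <= D)%N} -> (0 < P)%N -> (0 < #|S| <= n)%N ->
  (8 * kap * d * n <= P * epairs S S)%N -> has_dense_C4_free G kap.
Proof.
move=> degS P0 /andP[S0 Sn] geE; have /andP[p0 p1] := ratio_bounds.
have pgt0 : 0 < p by rewrite divr_gt0 ?ltr0n.
pose out u := if u \in S then nbr S u else set0.
pose E := [set e : G * G | (e.1 \in S) && (e.2 \in nbr S e.1)].
have out_adj u x : x \in out u -> adj u x.
  by rewrite /out; case: ifP => _; rewrite !inE // => /andP[].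
have outD u : (#|out u| <= D)%N.
  by rewrite /out; case: ifP => [/degS//|_]; rewrite cards0.
have ES : E \subset setX S S.
  by apply/subsetP=> e; rewrite !inE => /and3P[-> ->].
have irr : {in E, forall e, e.1 != e.2}.
  by move=> e; rewrite !inE => /and3P[_ _]; apply: contraTneq => ->; rewrite adj_irrefl.
have := expect_survivors_ge out_adj outD ES irr Sn; rewrite card_edge_set => /(_ geE) geX.
(* Survivors are sampled vertices, so a positive value means average degree above kap. *)
pose F A : R := \sum_(e in E) holds (survives out A e.1 && survives out A e.2)
   - kap%:R * #|S :&: A|%:R.
have [A leF] := expect_attained ratio_bounds F.
have {leF} Fpos : 0 < F A.
  apply: lt_le_trans leF; rewrite expectB expectZ expect_cardI.
  have kR : 1 <= kap%:R :> R by rewrite ler1n.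
  have e0 : 0 <= (epairs S S)%:R * p ^+ 2 / 8 by rewrite divr_ge0 ?ler0n // mulr_ge0 ?ler0n // exprn_ge0.
  have h1 : kap%:R * (#|S|%:R * p) <= kap%:R * (n%:R * p).
    by apply: ler_wpM2l; [lra|apply: ler_wpM2r => //; rewrite ler_nat].
  have h2 : 0 < kap%:R * (n%:R * p).
    by apply: mulr_gt0; [lra|apply: mulr_gt0 => //; rewrite ltr0n (leq_trans S0)].
  lra.
pose T := [set v in S | survives out A v].
have TS : T \subset S by apply/subsetP=> v; rewrite inE => /andP[].
have sumT : \sum_(e in E) holds (survives out A e.1 && survives out A e.2) = (epairs T T)%:R :> R.
  rewrite -card_edge_set -sum1_card natr_sum big_mkcond [RHS]big_mkcond.
  apply: eq_bigr => e _; rewrite !inE.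
  case: (e.1 \in S); case: (e.2 \in S); case: (adj _ _);
    by case: (survives out A e.1); case: (survives out A e.2).
have leT : #|T|%:R <= #|S :&: A|%:R :> R.
  rewrite ler_nat subset_leq_card //.
  by apply/subsetP=> v; rewrite !inE => /and3P[-> ->].
have kapT : (kap * #|T| < epairs T T)%N.
  rewrite -(ltr_nat R) natrM; move: Fpos; rewrite /F sumT.
  have : kap%:R * #|T|%:R <= kap%:R * #|S :&: A|%:R :> R.
    by apply: ler_wpM2l; rewrite ?ler0n.
  lra.
exists T; split; last exact: ltnW.
- have TA x : x \in T -> x \in A by rewrite inE => /and3P[].
  move=> x1 x2 x3 x4 i1 i2 i3 i4; apply/negP=> /and5P[a12 a23 a34 a41 /andP[n13 n24]].
  have /forall_inP/(_ (x2, x3, x4))/(_ _)/negP[] : [forall t in sourced_cycles out x1, ~~ (vertices t \subset A)].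
  + by move: i1; rewrite inE => /and3P[].
  + rewrite inE /out !(subsetP TS) // !in_nbr !(subsetP TS) //.
    by rewrite a12 a23 a34 n24 adj_sym a41 eq_sym n13.
  + by rewrite !subUset !sub1set !TA.
- by rewrite lt0n; apply: contraTneq kapT => T0; rewrite (cards0_eq T0) /epairs big_set0.
Qed.

End BoundedOut.

(** * Two shells: only alternating cycles survive *)

Section TwoSided.
Variables (G : sgraph) (L H : {set G}).
Hypothesis dLH : [disjoint L & H].

(* With these out-neighbourhoods the 4-cycles without a source are the alternating ones. *)
Definition out_LH u := if u \in L then nbr (L :|: H) u else if u \in H then nbr H u else set0.

(** A corner in [L] points to both its neighbours on the cycle. Survival then forbids those
    neighbours to point on to the opposite corner, which forces them into [H] and that corner into
    [L]. *)
Lemma survivors_alternating (A L' H' : {set G}) : L' \subset L -> H' \subset H ->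
  {in L' :|: H', forall u, survives out_LH A u} -> alternating L' H'.
Proof.
move=> L'L H'H surv.
have sub x : x \in L' :|: H' -> x \in L :|: H by apply: (subsetP (setUSS L'L H'H)).
have inA x : x \in L' :|: H' -> x \in A by move/surv/andP=> [].
have nLH x : x \in L -> (x \in H) = false by move=> xL; apply: disjointFr dLH xL.
have kill x1 x2 x3 x4 : x1 \in L' :|: H' -> x2 \in L' :|: H' -> x3 \in L' :|: H' ->
    x4 \in L' :|: H' -> cycle4 x1 x2 x3 x4 ->
    x2 \in out_LH x1 -> x3 \in out_LH x2 -> x4 \in out_LH x1 -> False.
  move=> i1 i2 i3 i4 /and5P[a12 a23 a34 a41 /andP[n13 n24]] o12 o23 o14.
  have /andP[_ /forall_inP/(_ (x2, x3, x4))/(_ _)/negP[]] := surv _ i1.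
    by rewrite inE o12 o23 o14 a34 n24 eq_sym n13.
  by rewrite !subUset !sub1set !inA.
have rot (x1 x2 x3 x4 : G) : cycle4 x1 x2 x3 x4 -> cycle4 x2 x3 x4 x1.
  by rewrite /cycle4 => /and5P[-> -> -> -> /andP[n13 ->]]; rewrite eq_sym n13.
have flip (x1 x2 x3 x4 : G) : cycle4 x1 x2 x3 x4 -> cycle4 x1 x4 x3 x2.
  move=> /and5P[a12 a23 a34 a41 /andP[n13 n24]].
  by apply/and5P; split; rewrite 1?adj_sym // n13 eq_sym.
(* Neighbours of an L-vertex on a surviving 4-cycle lie in H and its opposite vertex in L. *)
have atL x1 x2 x3 x4 : x1 \in L' :|: H' -> x2 \in L' :|: H' -> x3 \in L' :|: H' ->
    x4 \in L' :|: H' -> cycle4 x1 x2 x3 x4 -> x1 \in L -> (x2 \in H) && (x3 \in L).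
  move=> i1 i2 i3 i4 c4 x1L; have /and5P[a12 a23 a34 a41 _] := c4.
  have o12 : x2 \in out_LH x1 by rewrite /out_LH x1L in_nbr sub.
  have o14 : x4 \in out_LH x1 by rewrite /out_LH x1L in_nbr sub // adj_sym.
  have no23 : x3 \notin out_LH x2 by apply/negP=> o23; apply: (kill x1 x2 x3 x4).
  move: no23; rewrite /out_LH.
  have := sub _ i2; have := sub _ i3; rewrite !inE.
  case x2L: (x2 \in L); first by move=> /= h _; rewrite in_nbr inE h a23.
  by move=> + /= x2H; rewrite x2H in_nbr a23 andbT => /orP[->//|->].
move=> x1 x2 x3 x4 i1 i2 i3 i4 c4.
have c4' := rot _ _ _ _ c4; have c4'' := rot _ _ _ _ c4'; have c4''' := rot _ _ _ _ c4''.
have inL x : x \in L' :|: H' -> x \in L -> x \in L'.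
  by rewrite inE => /orP[//|/(subsetP H'H) xH xL]; rewrite nLH in xH.
have inH x : x \in L' :|: H' -> x \in H -> x \in H'.
  by rewrite inE => /orP[/(subsetP L'L)/nLH-> //|//].
have [x1L|x1L] := boolP (x1 \in L).
  have /andP[x2H x3L] := atL _ _ _ _ i1 i2 i3 i4 c4 x1L.
  have /andP[x4H _] := atL _ _ _ _ i1 i4 i3 i2 (flip _ _ _ _ c4) x1L.
  by rewrite (inL x1) // (inL x3) // (inH x2) // (inH x4).
have x1H : x1 \in H by move: (sub _ i1); rewrite inE (negPf x1L).
have [x2L|x2L] := boolP (x2 \in L).
  have /andP[x3H x4L] := atL _ _ _ _ i2 i3 i4 i1 c4' x2L.
  by rewrite (inL x2) // (inL x4) // (inH x1) // (inH x3) // orbT.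
have x2H : x2 \in H by move: (sub _ i2); rewrite inE (negPf x2L).
have [x3L|x3L] := boolP (x3 \in L).
  have /andP[_] := atL _ _ _ _ i3 i4 i1 i2 c4'' x3L.
  by rewrite (negPf x1L).
have x3H : x3 \in H by move: (sub _ i3); rewrite inE (negPf x3L).
have [x4L|x4L] := boolP (x4 \in L).
  have /andP[_] := atL _ _ _ _ i4 i1 i2 i3 c4''' x4L.
  by rewrite (negPf x2L).
have x4H : x4 \in H by move: (sub _ i4); rewrite inE (negPf x4L).
(* A cycle inside [H] has all its edges directed both ways, so x1 is a source. *)
have /and5P[a12 a23 a34 a41 _] := c4; case: (kill x1 x2 x3 x4) => //.
- by rewrite /out_LH (negPf x1L) x1H in_nbr x2H.
- by rewrite /out_LH (negPf x2L) x2H in_nbr x3H.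
- by rewrite /out_LH (negPf x1L) x1H in_nbr x4H adj_sym.
Qed.

Variables (R : realFieldType) (s k g D P d n K : nat).
Hypotheses (s0 : 0 < s) (g0 : 0 < g) (d0 : 0 < d) (k0 : 0 < k) (P0 : 0 < P) (Pd : P <= d).
Hypothesis fr : biclique_free G s.
Hypothesis geD : 2 * g * ((8 * g) ^ s * s) <= D.
Hypothesis geg : 16 * (P * D) ^ 3 <= g * d ^ 3.
Hypotheses (K0 : 0 < K) (geK : 32 * P <= K).

Local Open Scope ring_scope.

(** Besides killing sourced cycles, the sample must leave degrees at most [K] from [L] into [H].
    Overloaded vertices are dropped, and their edges are paid for by counting pairs of sampled
    neighbours. *)
Lemma two_sided_dense_C4_free :
  {in L, forall v, (#|nbr (L :|: H) v| <= D)%N} ->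
  {in H, forall v, (#|nbr H v| <= D)%N} ->
  {in L, forall v, (#|nbr H v| <= 4 * d)%N} ->
  (0 < n)%N -> (#|L| + #|H| <= n)%N ->
  (pair_degree s K s * #|H| <= side_degree k s * n)%N ->
  (8 * side_degree k s * d * n <= P * epairs L H)%N -> has_dense_C4_free G k.
Proof.
set X := pair_degree s K s; set kap := side_degree k s.
move=> degL degH degLH n0 LHn XH geE.
have kap0 : (0 < kap)%N by rewrite muln_gt0 expn_gt0 !muln_gt0 k0.
pose p : R := P%:R / d%:R.
have pb : 0 <= p <= 1 := ratio_bounds R d0 Pd.
have /andP[p0 p1] := pb.
have pgt0 : 0 < p by rewrite divr_gt0 ?ltr0n.
pose E := [set e : G * G | (e.1 \in L) && (e.2 \in nbr H e.1)].
have out_adj u x : x \in out_LH u -> adj u x.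
  by rewrite /out_LH; case: ifP => _; [|case: ifP => _]; rewrite !inE // => /andP[].
have outD u : (#|out_LH u| <= D)%N.
  by rewrite /out_LH; case: ifP => [/degL//|_]; case: ifP => [/degH//|_]; rewrite cards0.
have ES : E \subset setX (L :|: H) (L :|: H).
  by apply/subsetP=> e; rewrite !inE => /and3P[-> ->]; rewrite orbT.
have irr : {in E, forall e, e.1 != e.2}.
  by move=> e; rewrite !inE => /and3P[_ _]; apply: contraTneq => ->; rewrite adj_irrefl.
have cS : (#|L :|: H| <= n)%N by rewrite cardsU disjoint_setI0 // cards0 subn0.
have := expect_survivors_ge R s0 g0 d0 kap0 Pd fr geD geg out_adj outD ES irr cS.
rewrite card_edge_set => /(_ geE) geX.
pose surv (A : {set G}) : R := \sum_(e in E) holds (survives out_LH A e.1 && survives out_LH A e.2).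
(* Ordered pairs of sampled neighbours of a sampled v. Their expected total is at most 4P e(L,H)
   p^2, and K >= 32P keeps the charge within the slack. *)
pose tri (v : G) (A : {set G}) : R := \sum_(a in nbr H v) \sum_(b in nbr H v :\ a)
   holds ([set v; a; b] \subset A).
pose F (A : {set G}) : R := surv A - K%:R^-1 * \sum_(v in L) tri v A
   - (kap%:R * #|L :&: A|%:R + X%:R * #|H :&: A|%:R).
have [A leF] := expect_attained pb F.
have KR : 0 < K%:R :> R by rewrite ltr0n.
have dR : 0 < d%:R :> R by rewrite ltr0n.
have {leF} Fpos : 0 < F A.
  apply: lt_le_trans leF; rewrite !expectB expectD !expectZ !expect_cardI expect_sum.
  have triE : \sum_(v in L) expect p (tri v) <= (epairs L H)%:R * (4 * P%:R * p ^+ 2).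
    have -> : 4 * P%:R * p ^+ 2 = (4 * d%:R) * p ^+ 3.
      by rewrite /p; field; rewrite gt_eqF.
    rewrite natr_sum mulr_suml; apply: ler_sum => v vL; rewrite expect_sum.
    rewrite mulr_natl -sumr_const; apply: ler_sum => a; rewrite in_nbr => /andP[aH va].
    rewrite expect_sum.
    apply: le_trans (_ : \sum_(b in nbr H v :\ a) p ^+ 3 <= _).
      apply: ler_sum => b; rewrite in_setD1 in_nbr => /and3P[ba bH vb].
      have nva : v != a by apply: contraTneq va => ->; rewrite adj_irrefl.
      have nvb : v != b by apply: contraTneq vb => ->; rewrite adj_irrefl.
      by rewrite expect_subset setUC cardsU1 cards2 nva !inE negb_or ba [b == v]eq_sym nvb.
    rewrite sumr_const -[X in X <= _]mulr_natl ler_wpM2r ?exprn_ge0 // -natrM ler_nat.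
    by rewrite (leq_trans _ (degLH v vL)) // subset_leq_card // subsetDl.
  have kR : 1 <= kap%:R :> R by rewrite ler1n.
  have nR : 0 < n%:R :> R by rewrite ltr0n.
  have h1 : K%:R^-1 * \sum_(v in L) expect p (tri v) <= (epairs L H)%:R * p ^+ 2 / 8.
    rewrite mulrC ler_pdivrMr //; apply: le_trans triE _.
    have : 32 * P%:R <= K%:R :> R by rewrite -natrM ler_nat.
    have e0 : 0 <= (epairs L H)%:R * p ^+ 2 by rewrite mulr_ge0 ?ler0n // exprn_ge0.
    by move=> PK; have := ler_wpM2l e0 PK; lra.
  have h2 : kap%:R * (#|L|%:R * p) <= kap%:R * (n%:R * p).
    apply: ler_wpM2l; first lra; apply: ler_wpM2r => //.
    by rewrite ler_nat; apply: leq_trans LHn; apply: leq_addr.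
  have h3 : X%:R * (#|H|%:R * p) <= kap%:R * (n%:R * p).
    by rewrite [leLHS]mulrA [leRHS]mulrA; apply: ler_wpM2r => //; rewrite -!natrM ler_nat.
  have h4 : 0 < kap%:R * (n%:R * p) by apply: mulr_gt0; [lra|apply: mulr_gt0].
  have {}geX : 5 * kap%:R * n%:R * p + (epairs L H)%:R * p ^+ 2 / 8 <= expect p surv := geX.
  lra.
pose Hs := [set a in H | survives out_LH A a].
pose Z v := #|nbr (H :&: A) v|.
pose Ls := [set v in L | survives out_LH A v && (Z v <= K)%N].
have HsH : Hs \subset H by apply/subsetP=> v; rewrite inE => /andP[].
have LsL : Ls \subset L by apply/subsetP=> v; rewrite inE => /andP[].
have HsA : Hs \subset H :&: A by apply/subsetP=> v; rewrite !inE => /and3P[-> ->].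
have survE : surv A = \sum_(v in L) holds (survives out_LH A v) * #|nbr Hs v|%:R.
  rewrite /surv.
  rewrite (eq_bigl (fun e => (e.1 \in L) && (e.2 \in nbr H e.1))); last by move=> e; rewrite inE.
  rewrite -(pair_big_dep (fun v => v \in L) (fun v a => a \in nbr H v)
    (fun v a => holds (survives out_LH A v && survives out_LH A a))) /=.
  apply: eq_bigr => v _; rewrite card_nbrE natr_sum big_distrr /=.
  rewrite big_mkcond [RHS]big_mkcond; apply: eq_bigr => a _; rewrite !inE.
  rewrite /holds -!natrM; case: (a \in H) => //=; case: (adj v a);
    by case: (survives out_LH A v); case: (survives out_LH A a).
(* Each of the Z sampled neighbours forms a pair with Z - 1 >= K others. *)
have tri_ge v : survives out_LH A v -> (K < Z v)%N -> K%:R * (Z v)%:R <= tri v A.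
  move=> /andP[vA _] gtK.
  have -> : K%:R * (Z v)%:R = \sum_(a in nbr H v) K%:R * holds (a \in A) :> R.
    rewrite -big_distrr /= sum_holds; congr (_ * _%:R).
    by apply: eq_card => a; rewrite !inE andbAC.
  apply: ler_sum => a av; case aA: (a \in A); last first.
    by rewrite mulr0; apply: sumr_ge0 => b _; rewrite /holds ler0n.
  rewrite mulr1.
  have -> : \sum_(b in nbr H v :\ a) holds ([set v; a; b] \subset A) = #|(nbr H v :\ a) :&: A|%:R :> R.
    rewrite -sum_holds; apply: eq_bigr => b _; congr holds.
    by rewrite !subUset !sub1set vA aA.
  rewrite ler_nat -ltnS; apply: leq_trans gtK _.
  rewrite /Z (cardsD1 a) -add1n leq_add ?leq_b1 //.
  by apply/subset_leq_card/subsetP=> b; rewrite !inE => /and3P[-> /andP[-> ->] ->].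
have tri0 v : 0 <= tri v A.
  by apply: sumr_ge0 => a _; apply: sumr_ge0 => b _; rewrite /holds ler0n.
have per_v v : v \in L -> holds (survives out_LH A v) * #|nbr Hs v|%:R - K%:R^-1 * tri v A
    <= holds (v \in Ls) * #|nbr Hs v|%:R :> R.
  move=> vL; rewrite inE vL /=.
  have q0 : 0 <= K%:R^-1 * tri v A by rewrite mulr_ge0 // invr_ge0 ltW.
  have holds1 : holds true = 1 :> R by [].
  have holds0 : holds false = 0 :> R by [].
  have [sv|_] := boolP (survives out_LH A v); last by rewrite /= holds0 !mul0r; lra.
  have [_|gtK] := leqP; first by rewrite /= holds1 !mul1r; lra.
  rewrite /= holds0 holds1 mul0r mul1r subr_le0.
  apply: le_trans (_ : (Z v)%:R <= _); first by rewrite ler_nat subset_leq_card ?nbrS.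
  by rewrite ler_pdivlMl // tri_ge.
have eLs : kap%:R * #|Ls|%:R + X%:R * #|Hs|%:R < (epairs Ls Hs)%:R :> R.
  have -> : (epairs Ls Hs)%:R = \sum_(v in L) holds (v \in Ls) * #|nbr Hs v|%:R :> R.
    rewrite natr_sum big_mkcond [RHS]big_mkcond; apply: eq_bigr => v _.
    case vLs: (v \in Ls); first by rewrite (subsetP LsL _ vLs) mul1r.
    by rewrite mul0r; case: ifP.
  apply: lt_le_trans (ler_sum _ per_v).
  rewrite sumrB -survE -big_distrr /=.
  have h1 : kap%:R * #|Ls|%:R <= kap%:R * #|L :&: A|%:R :> R.
    apply: ler_wpM2l; rewrite ?ler0n // ler_nat subset_leq_card //.
    by apply/subsetP=> v; rewrite !inE => /and3P[-> /andP[-> _] _].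
  have h2 : X%:R * #|Hs|%:R <= X%:R * #|H :&: A|%:R :> R.
    by apply: ler_wpM2l; rewrite ?ler0n // ler_nat subset_leq_card.
  by move: Fpos; rewrite /F; lra.
apply: (@find_dense_C4_free G k s K k0 s0 K0 s Ls Hs).
- exact: disjointWl LsL (disjointWr HsH dLH).
- apply: (survivors_alternating LsL HsH (A := A)) => u; rewrite !inE.
  by case/orP=> [/and3P[]|/andP[]].
- move=> v; rewrite inE => /and3P[_ _]; apply: leq_trans.
  exact/subset_leq_card/nbrS.
- by move=> T _ cT; apply: biclique_free_common.
- by move: eLs; rewrite -!natrM -natrD ltr_nat.
Qed.
End TwoSided.

(** * The case of a large gap *)

Section ExactTraces.
Local Open Scope ring_scope.

(* Sampling at rate 1/(2u) keeps the c elements of T v and avoids U v with probability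
   at least (2u)^-c / 2. *)
Lemma sample_exact_traces (R : realFieldType) (V : finType) (L : {set V}) (T U : V -> {set V})
  (c u : nat) : (0 < u)%N ->
  {in L, forall v, #|T v| = c :> nat} -> {in L, forall v, (#|U v| <= u)%N} ->
  {in L, forall v, [disjoint T v & U v]} ->
  exists A : {set V}, (#|L| <= 2 * (2 * u) ^ c * #|[set v in L | (T v \subset A) && [disjoint U v & A]]|)%N.
Proof.
move=> u0 cT cU dTU.
have [q [q0 q1 uq]] : exists q : R, [/\ 0 < q, q <= 1 & 2 * u%:R * q = 1].
  have uR : 1 <= u%:R :> R by rewrite ler1n.
  have u2 : 0 < 2 * u%:R :> R by lra.
  exists (2 * u%:R)^-1; rewrite invr_gt0 u2 divff ?gt_eqF //; split=> //.
  by rewrite invf_le1 //; lra.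
have q01 : 0 <= q <= 1 by rewrite ltW.
(* A union-bound minorant of the desired event; its mean is at least q^c - u q^(c+1) = q^c/2 for q =
   1/(2u). *)
pose F v (A : {set V}) : R := holds (T v \subset A) - \sum_(x in U v) holds (x |: T v \subset A).
have EF v : v \in L -> q ^+ c / 2 <= expect q (F v).
  move=> vL; rewrite expectB expect_sum expect_subset cT //.
  have -> : (\sum_(x in U v) expect q (fun A => holds (x |: T v \subset A)) = #|U v|%:R * q ^+ c.+1)%R.
    rewrite mulr_natl -sumr_const; apply: eq_bigr => x xU.
    by rewrite expect_subset cardsU1 cT // (disjointFl (dTU _ vL) xU).
  have qc : 0 <= q ^+ c by rewrite exprn_ge0 ?ltW.
  have : #|U v|%:R * q <= u%:R * q by apply: ler_wpM2r; [exact: ltW | rewrite ler_nat cU].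
  have -> : u%:R * q = 2^-1 by lra.
  by move=> leU; have := ler_wpM2r qc leU; rewrite exprS; lra.
have [A] := expect_attained q01 (fun A => \sum_(v in L) F v A).
rewrite expect_sum => geA; exists A; set L1 := [set v in L | _].
have leF v : v \in L -> (F v A <= holds (v \in L1))%R.
  move=> vL; rewrite /F inE vL /=.
  have sum0 : (0 <= \sum_(x in U v) holds (x |: T v \subset A) :> R)%R.
    by apply: sumr_ge0 => x _; rewrite /holds ler0n.
  have holds1 : holds true = 1%R :> R by [].
  have holds0 : holds false = 0%R :> R by [].
  case TA: (T v \subset A) => /=; last by rewrite holds0; lra.
  have [_|/pred0Pn[x /= /andP[xU xA]]] := boolP [disjoint U v & A].
    by rewrite holds1; lra.
  rewrite (bigD1 x) //= subUset sub1set xA TA holds0 holds1.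
  have : (0 <= \sum_(i in U v | i != x) holds (i |: T v \subset A) :> R)%R.
    by apply: sumr_ge0 => i _; rewrite /holds ler0n.
  lra.
have : (#|L|%:R * (q ^+ c / 2) <= #|L1|%:R)%R.
  apply: le_trans (_ : (\sum_(v in L) holds (v \in L1) <= _)%R); last first.
    by rewrite sum_holds ler_nat subset_leq_card // subsetIr.
  apply: le_trans (ler_sum _ leF); apply: le_trans geA.
  by rewrite mulr_natl -sumr_const; apply: ler_sum.
rewrite -(ler_nat R) !natrM natrX natrM.
have u2 : (0 <= 2 * (2 * u%:R) ^+ c :> R)%R by rewrite mulr_ge0 ?exprn_ge0 ?mulr_ge0 ?ler0n.
move/(ler_wpM2l u2); congr (_ <= _)%R.
have -> : (2 * (2 * u%:R) ^+ c * (#|L|%:R * (q ^+ c / 2)) = #|L|%:R * (2 * u%:R * q) ^+ c)%R.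
  by rewrite [in RHS]exprMn; move: ((2 * u%:R) ^+ c) => b; field.
by rewrite uq expr1n mulr1.
Qed.

End ExactTraces.

Section Gap.
Variables (G : sgraph) (S L H : {set G}) (d s k K : nat).
Hypotheses (d0 : 0 < d) (s0 : 0 < s) (k0 : 0 < k).
Hypotheses (spS : sparse (2 * d) S) (LS : L \subset S) (HS : H \subset S).
Hypothesis dLH : [disjoint L & H].
Hypothesis fr : biclique_free G s.
Let c := 2 * side_degree k s.
Hypothesis cK : c <= K.
Hypothesis degL : {in L, forall v, 2 * (8 * c) * ((8 * (8 * c)) ^ s * s) <= #|nbr H v| <= 4 * d}.
Hypothesis gap : pair_degree s K s * #|H| * (2 * (2 * (4 * d + 2 * d * c)) ^ c * (2 * d).+1) < #|L|.

(** Give each v in [L] an independent set [T v] of [c] neighbours and sample so that exactly [T v]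
    remains in its neighbourhood. With both sides independent, all 4-cycles alternate; the gap in
    sizes pays for the low success probability. *)
Lemma gap_dense_C4_free : has_dense_C4_free G k.
Proof.
have kap0 : 0 < side_degree k s by rewrite muln_gt0 expn_gt0 !muln_gt0 k0.
have c0 : 0 < c by rewrite /c; lia.
have [out0 [out0d out0P]] := sparse_orientation spS.
pose out v := nbr (out0 v) v.
have outd : {in S, forall v, #|out v| <= 2 * d}.
  by move=> v vS; rewrite (leq_trans _ (out0d v vS)) // subset_leq_card ?nbr_sub.
have outP : {in S &, forall u v, adj u v -> (v \in out u) || (u \in out v)}.
  by move=> u v uS vS uv; rewrite !in_nbr uv adj_sym uv !andbT out0P.
have [T TP] : exists T : G -> {set G}, forall v, v \in L ->
    [/\ T v \subset nbr H v, #|T v| = c & {in T v &, forall x y, ~~ adj x y}].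
  apply: (@fin_all_exists _ (fun=> {set G}) (fun v T => v \in L ->
    [/\ T \subset nbr H v, #|T| = c & {in T &, forall x y, ~~ adj x y}])) => v.
  have [vL|] := boolP (v \in L); last by exists set0.
  have /andP[big _] := degL vL.
  by have [I IP] := biclique_free_independent s0 c0 fr big; exists I.
have TH v : v \in L -> T v \subset H.
  by move=> vL; have [TN _ _] := TP _ vL; apply: subset_trans TN (nbr_sub _ _).
(* What the sample must avoid: the other neighbours of v, and the out-neighbours that would remove a
   member of [T v] from H'. *)
pose U v := (nbr H v :|: \bigcup_(h in T v) out h) :\: T v.
have [||||A cA] := @sample_exact_traces rat G L T U c (4 * d + 2 * d * c).
- by rewrite addn_gt0 muln_gt0 d0.
- by move=> v /TP[].
- move=> v vL; have [TN cT _] := TP _ vL.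
  rewrite (leq_trans (subset_leq_card (subsetDl _ _))) //.
  rewrite (leq_trans (leq_card_setU _ _)) //; apply: leq_add.
    by have /andP[] := degL vL.
  apply: leq_trans (_ : \sum_(h in T v) #|out h| <= _).
    apply: (big_rec2 (fun (B : {set G}) m => #|B| <= m)) => [|h m B _ leB]; first by rewrite cards0.
    by rewrite (leq_trans (leq_card_setU _ _)) // leq_add2l.
  rewrite -cT mulnC -sum_nat_const; apply: leq_sum => h hT.
  by apply: outd; apply: (subsetP HS); apply: (subsetP (TH _ vL)).
- by move=> v vL; rewrite disjoint_sym /U; apply/pred0P=> x /=; rewrite !inE; case: (x \in T v); rewrite ?andbF.
set L1 := [set v in L | _] in cA.
have L1L : L1 \subset L by apply/subsetP=> v; rewrite inE => /andP[].
(* Dropping sampled vertices with a sampled out-neighbour makes H' independent, since every edge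
   within [S] is oriented. *)
pose H' := [set h in H | (h \in A) && [disjoint out h & A]].
have H'H : H' \subset H by apply/subsetP=> h; rewrite inE => /andP[].
have trace : {in L1, forall v, nbr H' v = T v}.
  move=> v; rewrite inE => /and3P[vL TA UA]; have [TN cT Tind] := TP _ vL.
  apply/setP=> h; apply/idP/idP.
    rewrite in_nbr inE => /andP[/and3P[hH hA _] vh]; apply/negPn/negP=> nT.
    have := disjointFl UA hA; rewrite !inE nT hH vh //.
  move=> hT; have := subsetP TN _ hT; rewrite !in_nbr inE => /andP[hH ->].
  rewrite hH (subsetP TA _ hT) /= andbT; apply/pred0P=> x /=; apply/negP=> /andP[xo xA].
  have nT : x \notin T v.
    by apply/negP=> xT; have := Tind _ _ hT xT; move: xo; rewrite in_nbr => /andP[_ ->].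
  have := disjointFl UA xA; rewrite in_setD nT in_setU.
  have -> : x \in \bigcup_(h in T v) out h by apply/bigcupP; exists h.
  by rewrite orbT.
have H'ind : {in H' &, forall x y, ~~ adj x y}.
  move=> x y; rewrite !inE => /and3P[xH xA dx] /and3P[yH yA dy]; apply/negP=> xy.
  have /orP[yx|] := outP _ _ (subsetP HS _ xH) (subsetP HS _ yH) xy.
    by rewrite (disjointFr dx yx) in yA.
  by move/(disjointFr dy); rewrite xA.
have [L2 [L2L1 L2ind cL2]] := sparse_independent (sparse_sub (subset_trans L1L LS) spS).
have L2L := subset_trans L2L1 L1L.
have dL2H' : [disjoint L2 & H'] by apply: disjointWl L2L (disjointWr H'H dLH).
have deg2 : {in L2, forall v, #|nbr H' v| = c}.
  move=> v vL2; rewrite trace ?(subsetP L2L1) //.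
  by have [_ -> _] := TP _ (subsetP L2L _ vL2).
apply: (@find_dense_C4_free G k s K k0 s0 _ s L2 H' dL2H').
- exact: leq_trans c0 cK.
- move=> x1 x2 x3 x4 i1 i2 i3 i4 /and5P[a12 a23 a34 a41 _].
  have LH x y : adj x y -> x \in L2 -> y \in L2 :|: H' -> y \in H'.
    move=> xy xL; rewrite inE => /orP[yL|//].
    by have := L2ind _ _ xL yL; rewrite xy.
  have HL x y : adj x y -> x \in H' -> y \in L2 :|: H' -> y \in L2.
    move=> xy xH; rewrite inE => /orP[//|yH].
    by have := H'ind _ _ xH yH; rewrite xy.
  move: (i1); rewrite inE => /orP[x1L|x1H].
    have x2H := LH _ _ a12 x1L i2; have x3L := HL _ _ a23 x2H i3.
    by rewrite x1L x2H x3L (LH _ _ a34 x3L i4).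
  have x2L := HL _ _ a12 x1H i2; have x3H := LH _ _ a23 x2L i3.
  by rewrite x1H x2L x3H (HL _ _ a34 x3H i4) orbT.
- by move=> v vL2; rewrite deg2.
- by move=> B _ cB; apply: biclique_free_common.
have -> : epairs L2 H' = c * #|L2|.
  by rewrite mulnC -sum_nat_const; apply: eq_bigr => v /deg2.
have cH' := subset_leq_card H'H.
have gap' := gap; set q := 2 * (2 * (4 * d + 2 * d * c)) ^ c in gap' cA.
(* The factors of [gap] are the sampling loss 2(2u)^c and the loss 2d + 1 from making [L2]
   independent. *)
have L2big : pair_degree s K s * #|H| < #|L2|.
  have qpos : 0 < q * (2 * d).+1 by rewrite muln_gt0 /q muln_gt0 expn_gt0; lia.
  rewrite -(ltn_pmul2r qpos); apply: leq_trans gap' _; apply: leq_trans cA _.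
  by rewrite [leqRHS]mulnC -mulnA leq_mul2l cL2 orbT.
have : pair_degree s K s * #|H'| <= pair_degree s K s * #|H| by rewrite leq_mul2l cH' orbT.
rewrite /c; move: (pair_degree s K s) L2big => X; nia.
Qed.
End Gap.

(** * Levels *)

Section Levels.
Variables (G : sgraph) (S : {set G}) (d lam : nat).
Hypotheses (d0 : 0 < d) (spS : sparse (2 * d) S) (lam4 : 4 <= lam).

Fixpoint level i : {set G} :=
  if i is j.+1 then [set x in level j | 2 * d * lam <= #|nbr (level j) x|] else S.

Definition shell i := level i :\: level i.+1.

Lemma levelS i : level i.+1 \subset level i.
Proof. by apply/subsetP=> x; rewrite inE => /andP[]. Qed.

Lemma level_sub i : level i \subset S.
Proof. by elim: i => // i IH; apply: subset_trans (levelS i) IH. Qed.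

Lemma level_sub1 i : 0 < i -> level i \subset level 1.
Proof.
by case: i => // i _; elim: i => // i IH; apply: subset_trans (levelS _) IH.
Qed.

Lemma shell_level i : shell i \subset level i.
Proof. exact: subsetDl. Qed.

(** Vertices of the next level have degree at least 2d lam, but the average degree in the level is
    at most 2d. *)
Lemma card_levelS i : lam * #|level i.+1| <= #|level i|.
Proof.
have h1 : 2 * d * lam * #|level i.+1| <= epairs (level i.+1) (level i).
  by apply: epairs_geq => x; rewrite inE => /andP[].
have h2 := epairsS (levelS i) (subxx (level i)).
have := spS (level_sub i); nia.
Qed.

Lemma card_level i : lam ^ i * #|level i| <= #|S|.
Proof.
elim: i => [|i IH]; first by rewrite expn0 mul1n.
apply: leq_trans IH; rewrite expnSr -mulnA leq_mul2l card_levelS orbT //.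
Qed.

Lemma card_level_pos i : 0 < i -> lam * #|level i| <= #|S|.
Proof.
case: i => // i _; apply: leq_trans (card_levelS i) _.
exact/subset_leq_card/level_sub.
Qed.

Lemma shell_degree i : {in shell i, forall x, #|nbr (level i) x| <= 2 * d * lam}.
Proof. by move=> x /setDP[xi]; rewrite inE xi /= -ltnNge => /ltnW. Qed.

Lemma disjoint_shell0 i : 0 < i -> [disjoint shell 0 & level i].
Proof.
move=> i0; apply: disjointWr (level_sub1 i0) _.
by rewrite disjoints_subset; apply/subsetP=> x /setDP[_ nx]; rewrite in_setC.
Qed.

(** Pairs inside level 1 number at most 2d|S|/4, half of the guaranteed total; the others have an
    end in the bottom shell and are counted at most twice. *)
Lemma shell0_pairs : d * #|S| <= epairs S S -> d * #|S| <= 4 * epairs (shell 0) S.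
Proof.
move=> dS.
have h1 : epairs S S = epairs (level 1) S + epairs (shell 0) S.
  by rewrite (epairs_setID (level 1) S S) (setIidPr (level_sub 1)).
have h2 : epairs (level 1) S = epairs (level 1) (level 1) + epairs (shell 0) (level 1).
  by rewrite (epairsC (level 1) S) (epairs_setID (level 1) S) (setIidPr (level_sub 1)).
have h3 := epairsS (subxx (shell 0)) (level_sub 1).
have h4 := spS (level_sub 1).
have h5 : 4 * #|level 1| <= #|S|.
  by apply: leq_trans (card_levelS 0); rewrite leq_mul2r lam4 orbT.
have h6 : d * (4 * #|level 1|) <= d * #|S| by rewrite leq_mul2l h5 orbT.
lia.
Qed.

Lemma sum_shells m :
  epairs (shell 0) S = \sum_(i < m) epairs (shell 0) (shell i) + epairs (shell 0) (level m).
Proof.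
elim: m => [|m IH]; first by rewrite big_ord0.
rewrite IH big_ord_recr /= -addnA; congr (_ + _).
rewrite !(epairsC (shell 0)) (epairs_setID (level m.+1) (level m)).
by rewrite (setIidPr (levelS m)) addnC.
Qed.

(** Either the top level receives half of the guaranteed pairs, or one of the [m] shells receives an
    average share of the rest. *)
Lemma shell_or_level m : 0 < m -> d * #|S| <= epairs S S ->
  d * #|S| <= 8 * epairs (shell 0) (level m) \/
  exists2 i, i < m & d * #|S| <= 8 * m * epairs (shell 0) (shell i).
Proof.
move=> m0 /shell0_pairs; rewrite (sum_shells m) => dS.
have [|lt] := leqP (d * #|S|) (8 * epairs (shell 0) (level m)); first by left.
right; have [/existsP[i hi]|/existsPn low] :=
  boolP [exists i : 'I_m, d * #|S| <= 8 * m * epairs (shell 0) (shell i)].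
  by exists i.
have : \sum_(i < m) (8 * m * epairs (shell 0) (shell i) + 1) <= \sum_(i < m) d * #|S|.
  by apply: leq_sum => i _; have := low i; rewrite -ltnNge addn1.
rewrite big_split /= -big_distrr /= !sum_nat_const card_ord muln1.
move: (\sum_(i < m) _) dS => E dS; nia.
Qed.

Variables (s k m P g K : nat).
Let kap := side_degree k s.
Let X := pair_degree s K s.
Let c := 2 * kap.
Hypotheses (s0 : 0 < s) (k0 : 0 < k) (m0 : 0 < m) (g0 : 0 < g).
Hypothesis fr : biclique_free G s.
Hypotheses (lam32 : 32 * m <= lam) (PE : P = 128 * m * kap) (Pd : P <= d).
Hypotheses (K32 : 32 * P <= K) (Xlam : X <= lam).
Hypothesis geg : 1024 * (P ^ 3 * lam ^ 3) <= g.
Hypothesis ged : 2 * g * ((8 * g) ^ s * s) <= d.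
Hypothesis gec : 32 * (2 * (8 * c) * ((8 * (8 * c)) ^ s * s)) <= d.
Hypothesis gap : 128 * (X * (2 * (2 * (4 * d + 2 * d * c)) ^ c * (2 * d).+1)) < lam ^ m.
Hypotheses (S0 : 0 < #|S|) (dS : d * #|S| <= epairs S S).

Lemma kap_ge : k <= kap.
Proof.
rewrite /kap /side_degree; apply: leq_trans (_ : (64 * 128 * (k * k)) ^ 1 * 2 <= _).
  by rewrite expn1; nia.
by rewrite leq_mul2r leq_pexp2l ?muln_gt0 ?k0.
Qed.

Lemma ged4 : 2 * g * ((8 * g) ^ s * s) <= 4 * d * lam.
Proof. by apply: leq_trans ged _; nia. Qed.

Lemma geg4 : 16 * (P * (4 * d * lam)) ^ 3 <= g * d ^ 3.
Proof.
apply: leq_trans (_ : 1024 * (P ^ 3 * lam ^ 3) * d ^ 3 <= _); last by rewrite leq_mul2r geg orbT.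
rewrite !expnMn; lia.
Qed.

(** Three cases, by where the bottom shell sends many edges: to level [m], within itself, or to a
    higher shell. *)
Lemma sparse_dense_C4_free : has_dense_C4_free G k.
Proof.
have kapk := kap_ge.
have P0 : 0 < P by rewrite PE !muln_gt0 m0; lia.
have K0 : 0 < K by lia.
have lam_ge : 32 <= lam by lia.
have S0S : shell 0 \subset S := shell_level 0.
have n128 : 128 * m * kap * (d * #|S|) <= P * (d * #|S|) by rewrite PE.
case: (shell_or_level m0 dS) => [big|[[|i] im big]].
- pose H := level m.
  have HS : H \subset S := level_sub m.
  have dis := disjoint_shell0 m0.
  (* Of the d|S|/8 pairs, low degrees take at most d|S|/32 and high degrees at most d|S|/16. The
     remaining d|S|/32, at most 4d per vertex, give |S| <= 128|L|. *)
  pose L := [set v in shell 0 | (d <= 32 * #|nbr H v|) && (#|nbr H v| <= 4 * d)].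
  have LS0 : L \subset shell 0 by apply/subsetP=> v; rewrite inE => /andP[].
  have cH := card_level_pos m0.
  have nL : #|S| <= 128 * #|L|.
    pose Lhi := [set v in shell 0 | 4 * d < #|nbr H v|].
    pose Llo := [set v in shell 0 | 32 * #|nbr H v| < d].
    have h1 : epairs Lhi H <= 2 * d * #|H| by apply: sparse_high_degree spS _ _ dis.
    have h2 : 32 * epairs Llo H <= d * #|S|.
      apply: leq_trans (_ : d * #|Llo| <= _).
        rewrite /epairs big_distrr /= mulnC -sum_nat_const; apply: leq_sum => v.
        by rewrite inE => /andP[_ /ltnW].
      rewrite leq_mul2l subset_leq_card ?orbT //; apply: subset_trans S0S.
      by apply/subsetP=> v; rewrite inE => /andP[].
    have h3 : epairs L H <= 4 * d * #|L|.
      by apply: epairs_leq => v; rewrite inE => /and3P[].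
    have h4 : epairs (shell 0) H <= epairs Lhi H + (epairs L H + epairs Llo H).
      rewrite (epairs_setID Lhi) leq_add ?epairsS ?subsetIr //.
      rewrite (epairs_setID L) leq_add ?epairsS ?subsetIr //.
      apply/subsetP=> v /setDP[/setDP[v0 nhi] nL]; move: nL nhi.
      rewrite [v \in L]inE [v \in Lhi]inE [v \in Llo]inE v0 /= -leqNgt => + hi.
      by rewrite hi andbT -ltnNge.
    have h5 : 32 * #|H| <= #|S| by apply: leq_trans cH; rewrite leq_mul2r lam_ge orbT.
    have h6 : d * (32 * #|H|) <= d * #|S| by rewrite leq_mul2l h5 orbT.
    rewrite -(leq_pmul2l d0); rewrite -/H in big; lia.
  apply: (@gap_dense_C4_free G S L H d s k K) => //.
  + exact: subset_trans LS0 S0S.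
  + exact: disjointWl LS0 dis.
  + have le1 : kap <= 128 * m * kap by rewrite leq_pmull // muln_gt0 m0.
    by rewrite -/kap; lia.
  + move=> v; rewrite inE => /and3P[_ dv ->]; rewrite andbT -/kap -/c.
    rewrite -(leq_pmul2l (isT : 0 < 32)); exact: leq_trans dv.
  move: gap; rewrite -/X -/kap -/c; move: (2 * (2 * (4 * d + 2 * d * c)) ^ c * (2 * d).+1) => q gapq.
  have lamH := card_level m; rewrite -/H in lamH.
  have [H0|H0] := posnP #|H|; first by rewrite H0 muln0 mul0n; lia.
  have : 128 * (X * q) * #|H| < lam ^ m * #|H| by rewrite ltn_pmul2r.
  rewrite [X * _ * _]mulnAC; lia.
- apply: (@regular_dense_C4_free rat G s g (4 * d * lam) P d #|S| k) => //.
  + exact: ged4.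
  + exact: geg4.
  + move=> v v0; apply: leq_trans (_ : 2 * d * lam <= _); last by rewrite -!mulnA leq_mul2r orbT.
    apply: leq_trans (shell_degree v0); exact/subset_leq_card/nbrS/shell_level.
  + apply/andP; split; last exact: subset_leq_card S0S.
    rewrite lt0n; apply: contraTneq big => /cards0_eq->.
    by rewrite /epairs big_set0 muln0 -ltnNge muln_gt0 d0.
  + have : 16 * kap * (d * #|S|) <= 16 * kap * (8 * m * epairs (shell 0) (shell 0)).
      by rewrite leq_mul2l big orbT.
    have : 8 * k * (d * #|S|) <= 16 * kap * (d * #|S|) by rewrite leq_mul2r; apply/orP; right; lia.
    rewrite PE; lia.
pose H := shell i.+1.
have HS : H \subset S by apply: subset_trans (shell_level _) (level_sub _).
have dis : [disjoint shell 0 & H].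
  by apply: disjointWr (shell_level _) (disjoint_shell0 _).
(* These vertices carry at most 2d|H| <= d|S|/(16m) pairs, half of the share of this shell. *)
pose Lhi := [set v in shell 0 | 4 * d < #|nbr H v|].
pose L := shell 0 :\: Lhi.
have LS0 : L \subset shell 0 := subsetDl _ _.
have cH : lam * #|H| <= #|S|.
  apply: leq_trans (card_level_pos (ltn0Sn i)); rewrite leq_mul2l.
  by rewrite subset_leq_card ?orbT // shell_level.
have h1 : epairs Lhi H <= 2 * d * #|H| by apply: sparse_high_degree spS _ _ dis.
have eL : d * #|S| <= 16 * m * epairs L H.
  have h2 : epairs (shell 0) H <= epairs Lhi H + epairs L H.
    by rewrite (epairs_setID Lhi) leq_add ?epairsS ?subsetIr.
  have h3 : d * (32 * m * #|H|) <= d * #|S|.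
    by rewrite leq_mul2l (leq_trans _ cH) ?orbT // leq_mul2r lam32 orbT.
  have h4 : 16 * m * epairs (shell 0) H <= 16 * m * (2 * d * #|H| + epairs L H).
    by rewrite leq_mul2l; apply/orP; right; lia.
  rewrite -/H in big; lia.
have degL : {in L, forall v, #|nbr H v| <= 4 * d}.
  by move=> v /setDP[v0]; rewrite inE v0 /= -leqNgt.
have degS0 : {in shell 0, forall v, #|nbr (shell 0) v| <= 2 * d * lam}.
  move=> v v0; apply: leq_trans (shell_degree v0); exact/subset_leq_card/nbrS/shell_level.
have le4 : 2 * d * lam + 4 * d <= 4 * d * lam.
  have : d * 2 <= d * lam by rewrite leq_mul2l; apply/orP; right; lia.
  lia.
apply: (@two_sided_dense_C4_free G L H _ rat s k g (4 * d * lam) P d #|S| K) => //.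
- exact: disjointWl LS0 dis.
- exact: ged4.
- exact: geg4.
- move=> v vL; have v0 := subsetP LS0 _ vL.
  apply: leq_trans (_ : #|nbr L v| + #|nbr H v| <= _).
    rewrite (leq_trans _ (leq_card_setU _ _)) // subset_leq_card //.
    by apply/subsetP=> x; rewrite !inE => /andP[/orP[]-> ->]; rewrite ?orbT.
  apply: leq_trans le4; rewrite leq_add ?degL // (leq_trans _ (degS0 v v0)) //.
  exact/subset_leq_card/nbrS.
- move=> v vH; apply: leq_trans (_ : 2 * d * lam <= _); last by rewrite -!mulnA leq_mul2r orbT.
  apply: leq_trans (shell_degree vH); exact/subset_leq_card/nbrS/shell_level.
- have dLH : [disjoint L & H] by apply: disjointWl LS0 dis.
  have -> : #|L| + #|H| = #|L :|: H| by rewrite cardsU disjoint_setI0 // cards0 subn0.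
  by rewrite subset_leq_card // subUset HS (subset_trans LS0 S0S).
- rewrite -/X -/kap; apply: leq_trans (_ : 1 * #|S| <= _).
    by rewrite mul1n (leq_trans _ cH) // leq_mul2r Xlam orbT.
  by rewrite leq_mul2r; apply/orP; right; lia.
rewrite -/kap.
have : 8 * kap * (d * #|S|) <= 8 * kap * (16 * m * epairs L H) by rewrite leq_mul2l eL orbT.
rewrite PE; lia.
Qed.

End Levels.

(** * Average degree and induced subgraphs *)

(** Take an inclusion-minimal dense set. Its proper subsets have average degree below d, or are
    empty; deleting one vertex bounds the set itself by (d + 2)(|S| - 1) pairs, which is at most
    2d|S| because d > 1. *)
Lemma dense_sparse_subset (G : sgraph) (d : nat) : 1 < d -> 0 < #|G| ->
  d * #|G| <= epairs [set: G] [set: G] ->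
  exists S : {set G}, [/\ 0 < #|S|, d * #|S| <= epairs S S & sparse (2 * d) S].
Proof.
move=> d1 G0 dG; pose dense (S : {set G}) := (0 < #|S|) && (d * #|S| <= epairs S S).
have denseT : dense [set: G] by rewrite /dense cardsT G0.
have [S /minsetP[/andP[S0 dS] minS]] : {S | minset dense S}.
  by apply: ex_minset; exists [set: G].
exists S; split=> // T TS.
have [->|neTS] := eqVneq T S; last first.
  have [T0|T0] := posnP #|T|; first by rewrite (cards0_eq T0) /epairs big_set0.
  have : ~~ dense T by apply: contraNN neTS => /minS->.
  by rewrite /dense T0 -ltnNge /=; nia.
have [w wS] := card_gt0P S0.
have leS A : #|nbr A w| <= #|A| by apply/subset_leq_card/nbr_sub.
have sub1 : S :\ w \subset S := subsetDl _ _.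
have e1 := epairsD1 S wS.
have e2 := epairsD1 (S :\ w) wS.
rewrite (epairsC (S :\ w)) in e1.
have c1 := cardsD1 w S; rewrite wS in c1.
have h1 := leS S; have h2 := leS (S :\ w).
suff : epairs (S :\ w) (S :\ w) <= d * #|S :\ w| by nia.
have [E0|E0] := posnP #|S :\ w|; first by rewrite (cards0_eq E0) /epairs big_set0.
have : ~~ dense (S :\ w).
  by apply/negP=> /minS/(_ sub1) SwS; move: wS; rewrite -SwS !inE eqxx.
by rewrite /dense E0 -ltnNge /=; apply: ltnW.
Qed.

Lemma card_edges (G : sgraph) : 2 * #|edges G| = epairs [set: G] [set: G].
Proof.
pose P := [set q : G * G | adj q.1 q.2].
have <- : #|P| = epairs [set: G] [set: G].
  rewrite -sum1_card /epairs.
  under [RHS]eq_bigr do rewrite -sum1_card.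
  by rewrite pair_big_dep /=; apply: eq_bigl => -[x y]; rewrite !inE.
rewrite -[RHS]sum1_card.
rewrite (partition_big (fun q : G * G => [set q.1; q.2]) (fun e => e \in edges G)) /=; last first.
  move=> [x y]; rewrite !inE /= => xy.
  by apply/existsP; exists x; apply/existsP; exists y; rewrite xy eqxx.
rewrite mulnC -sum_nat_const; apply: eq_bigr => e; rewrite inE.
case/existsP=> x /existsP[y /andP[xy /eqP->]].
have nxy : x != y by apply: contraTneq xy => ->; rewrite adj_irrefl.
rewrite sum1_card; transitivity #|[set (x, y); (y, x)]|.
  by rewrite cards2 xpair_eqE negb_and nxy.
apply: eq_card => -[a b]; rewrite [RHS]unfold_in !inE /= !xpair_eqE.
apply/idP/idP => [/orP[/andP[/eqP-> /eqP->]|/andP[/eqP-> /eqP->]]|/andP[ab /eqP/setP E]].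
- by rewrite xy eqxx.
- by rewrite adj_sym xy setUC eqxx.
- have nab : a != b by apply: contraTneq ab => ->; rewrite adj_irrefl.
  have := E a; have := E b; rewrite !inE !eqxx orbT /=.
  case/esym/orP=> /eqP Eb; case/esym/orP=> /eqP Ea; subst; rewrite ?eqxx ?orbT //.
    by rewrite eqxx in nab.
  by rewrite eqxx in nab.
Qed.

Lemma epairs_induced (G : sgraph) (S : {set G}) :
  epairs [set: induced S] [set: induced S] = epairs S S.
Proof.
have sumS (F : G -> nat) : \sum_(u in [set: induced S]) F (val u) = \sum_(x in S) F x.
  rewrite (eq_bigl xpredT) => [|u]; last by rewrite inE.
  rewrite [RHS](reindex_omap (val : {x | x \in S} -> G) insub) /=.
    by apply: eq_bigl => -[x xS] /=; rewrite insubT xS /= eqxx.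
  by move=> x xS; rewrite insubT.
rewrite /epairs -sumS; apply: eq_bigr => u _.
rewrite !card_nbrE -sumS; apply: eq_bigr => v _ //.
Qed.

Lemma C4_free_induced (G : sgraph) (S : {set G}) : C4_free_on S -> free_of C4 (induced S).
Proof.
move=> frS [f [injf adjf]].
pose i (n : nat) : C4 := inord n : 'I_4.
pose x n := val (f (i n)).
have xS n : x n \in S := valP (f (i n)).
have adjx (a b : nat) : a < 4 -> b < 4 -> b = a.+1 %% 4 -> adj (x a) (x b).
  move=> a4 b4 E; apply: (adjf (i a) (i b)); rewrite /= /C4_adj !inordK //.
  by rewrite E eqxx.
have nx (a b : nat) : a < 4 -> b < 4 -> a != b -> x a != x b.
  move=> a4 b4; apply: contraNneq => /val_inj/injf E.
  by apply/eqP; rewrite -(inordK a4) -(inordK b4) -/(i a) -/(i b) E.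
have /negP[] := frS _ _ _ _ (xS 0) (xS 1) (xS 2) (xS 3).
by rewrite /cycle4 !adjx ?nx.
Qed.

Lemma free_biclique_free (G : sgraph) s : free_of (Kmn s s) G -> biclique_free G s.
Proof.
move=> fr T U cT cU adjTU; apply: fr.
pose f (u : Kmn s s) : G := match u with
  | inl i => enum_val (widen_ord cT i) | inr j => enum_val (widen_ord cU j) end.
have fT i : f (inl i) \in T by apply: enum_valP.
have fU j : f (inr j) \in U by apply: enum_valP.
have fTU i j : adj (f (inl i)) (f (inr j)) by apply: adjTU.
have neq i j : f (inl i) <> f (inr j) by move=> E; have := fTU i j; rewrite E adj_irrefl.
exists f; split.
- move=> [i|i] [j|j] => [/enum_val_inj E|/neq//|/esym/neq//|/enum_val_inj E].
  + by congr inl; apply: val_inj; exact: (congr1 val E).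
  + by congr inr; apply: val_inj; exact: (congr1 val E).
- by move=> [i|i] [j|j] //= _; rewrite ?[adj (enum_val (widen_ord cU _)) _]adj_sym; apply: fTU.
Qed.

Lemma has_dense_C4_free_induced (G : sgraph) k : has_dense_C4_free G k ->
  exists S : {set G}, free_of C4 (induced S) /\ (k%:R <= avg_degree (induced S))%R.
Proof.
move=> [S [frS S0 dS]]; exists S; split; first exact: C4_free_induced.
have cS : #|induced S| = #|S| by rewrite card_sig; apply: eq_card.
rewrite /avg_degree card_edges epairs_induced cS ler_pdivlMr ?ltr0n //.
by rewrite -natrM ler_nat.
Qed.

(* All parameters are bounded by powers of k, which turns the required inequalities
   into inequalities between exponents. *)
Section PowersOfK.
Variables (k s e h f : nat).
Hypotheses (k2 : 1 < k) (s0 : 0 < s).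
Hypotheses (e_ge : 7 * 58 + 5 <= e) (h_ge : 169 + 3 * e <= h).
Hypotheses (f_ge : 2 * h + 5 <= f) (f_le : f + 20 <= 8 * e).

Lemma leq_pow_const i n : n <= 2 ^ i -> n <= k ^ i.
Proof. by move/leq_trans; apply; case: i => // i; rewrite leq_exp2r. Qed.

Lemma leq_pow_mul a b c x y : x <= k ^ a -> y <= k ^ b -> a + b <= c -> x * y <= k ^ c.
Proof.
move=> xa yb abc; apply: leq_trans (leq_mul xa yb) _.
by rewrite -expnD leq_pexp2l // ltnW.
Qed.

Lemma leq_pow_pow a n c x : x <= k ^ a -> a * n <= c -> x ^ n <= k ^ c.
Proof.
move=> xa anc; have [->|n0] := posnP n; first by rewrite expn0 expn_gt0 ltnW.
apply: leq_trans (_ : (k ^ a) ^ n <= _); first by rewrite leq_exp2r.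
by rewrite -expnM leq_pexp2l // ltnW.
Qed.

Lemma leq_pow_weak a b x : x <= k ^ a -> a <= b -> x <= k ^ b.
Proof. by move=> xa ab; apply: leq_trans xa _; rewrite leq_pexp2l // ltnW. Qed.

(** Origin of the cube: [K] has exponent of order s, so [X], about K^(7s), has order s^2. Then [lam]
    must dominate [X], [g] must dominate lam^3, and the edge bound needs d to exceed g^s, of order
    s^3. The number [m] of levels must outgrow s c. *)
Let t2 := s * s.
Let t3 := s * s * s.
Let m := k ^ (30 * s).
Let kap := side_degree k s.
Let P := 128 * m * kap.
Let K := k ^ (58 * s).
Let X := pair_degree s K s.
Let lam := k ^ (e * t2).
Let g := k ^ (h * t2).
Let d := k ^ (f * t3).
Let c := 2 * kap.

Let t12 : s <= t2. Proof. by rewrite /t2 leq_pmulr. Qed.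
Let t23 : t2 <= t3. Proof. by rewrite /t2 /t3 leq_pmulr. Qed.

Lemma s_pow : s <= k ^ s.
Proof. by apply: leq_pow_const; apply/ltnW/ltn_expl. Qed.

Lemma kap_pow : kap <= k ^ (16 * s).
Proof.
apply: (@leq_pow_mul (15 * s) 1); [|exact: leq_pow_const|lia].
apply: (@leq_pow_pow 15) => //.
apply: (@leq_pow_mul 13 2); [|by rewrite expnS expn1|by []].
by apply: (@leq_pow_mul 6 7); rewrite ?leq_pow_const.
Qed.

Lemma P_pow : P <= k ^ (53 * s).
Proof.
apply: (@leq_pow_mul (7 + 30 * s) (16 * s)); [|exact: kap_pow|lia].
by apply: (@leq_pow_mul 7 (30 * s)); [exact: leq_pow_const|exact: leqnn|by []].
Qed.

Lemma X_pow : X <= k ^ ((7 * 58 + 5) * t2).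
Proof.
apply: (@leq_pow_mul ((4 + 58 * s * 7) * s) s); [|exact: s_pow|rewrite /t2; nia].
apply: (@leq_pow_pow (4 + 58 * s * 7)) => //.
apply: (@leq_pow_mul 4 (58 * s * 7)) => //; first exact: leq_pow_const.
exact: (@leq_pow_pow (58 * s)).
Qed.

Lemma c_pow : c <= k ^ (17 * s).
Proof. by apply: (@leq_pow_mul 1 (16 * s)); [exact: leq_pow_const|exact: kap_pow|lia]. Qed.

Lemma c_gt1 : 1 < c.
Proof.
rewrite /c /kap /side_degree; have : 0 < (64 * 128 * (k * k)) ^ s.
  by rewrite expn_gt0 !muln_gt0 (ltnW k2).
by move: (_ ^ s) => x; lia.
Qed.

Lemma lam_ge : 32 * m <= lam.
Proof. by apply: (@leq_pow_mul 5 (30 * s)); [exact: leq_pow_const|exact: leqnn|nia]. Qed.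

Lemma P_le_d : P <= d.
Proof. by apply: leq_pow_weak P_pow _; nia. Qed.

Lemma K_ge : 32 * P <= K.
Proof. by apply: (@leq_pow_mul 5 (53 * s)); [exact: leq_pow_const|exact: P_pow|lia]. Qed.

Lemma X_le_lam : X <= lam.
Proof. by apply: leq_pow_weak X_pow _; rewrite leq_mul2r e_ge orbT. Qed.

Lemma g_ge : 1024 * (P ^ 3 * lam ^ 3) <= g.
Proof.
apply: (@leq_pow_mul 10 (159 * s + 3 * e * t2)); first exact: leq_pow_const.
  apply: (@leq_pow_mul (159 * s) (3 * e * t2)) => //.
    by apply: (leq_pow_pow P_pow); lia.
  by rewrite /lam -expnM leq_pexp2l ?(ltnW k2) //; lia.
have : (169 + 3 * e) * t2 <= h * t2 by rewrite leq_mul2r h_ge orbT.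
lia.
Qed.

Lemma d_ge_g : 2 * g * ((8 * g) ^ s * s) <= d.
Proof.
apply: (@leq_pow_mul (1 + h * t2) ((3 + h * t2) * s + s)).
- by apply: (@leq_pow_mul 1 (h * t2)); [exact: leq_pow_const|exact: leqnn|by []].
- apply: (@leq_pow_mul ((3 + h * t2) * s) s); [|exact: s_pow|by []].
  apply: (@leq_pow_pow (3 + h * t2)) => //.
  by apply: (@leq_pow_mul 3 (h * t2)); [exact: leq_pow_const|exact: leqnn|by []].
have : (2 * h + 5) * t3 <= f * t3 by rewrite leq_mul2r f_ge orbT.
have : h * t2 <= h * t3 by rewrite leq_mul2l t23 orbT.
have -> : (3 + h * t2) * s = 3 * s + h * t3 by rewrite /t2 /t3; lia.
lia.
Qed.

Lemma d_ge_c : 32 * (2 * (8 * c) * ((8 * (8 * c)) ^ s * s)) <= d.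
Proof.
apply: (@leq_pow_mul 5 (4 + 17 * s + ((6 + 17 * s) * s + s))); first exact: leq_pow_const.
  apply: (@leq_pow_mul (4 + 17 * s) ((6 + 17 * s) * s + s)) => //.
    apply: (@leq_pow_mul 1 (3 + 17 * s)); [exact: leq_pow_const| |lia].
    by apply: (@leq_pow_mul 3 (17 * s)); [exact: leq_pow_const|exact: c_pow|by []].
  apply: (@leq_pow_mul ((6 + 17 * s) * s) s); [|exact: s_pow|by []].
  apply: (@leq_pow_pow (6 + 17 * s)) => //.
  apply: (@leq_pow_mul 3 (3 + 17 * s)); [exact: leq_pow_const| |lia].
  by apply: (@leq_pow_mul 3 (17 * s)); [exact: leq_pow_const|exact: c_pow|by []].
have : 50 * t3 <= f * t3 by rewrite leq_mul2r; apply/orP; right; lia.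
have -> : (6 + 17 * s) * s = 6 * s + 17 * t2 by rewrite /t2; lia.
lia.
Qed.

(** Compare exponents of [k]. The left side is dominated by (f + 20) s^3 c <= 8 e s^3 c, while m >=
    19 s c makes the right side at least 19 e s^3 c. *)
Lemma lam_gap : 128 * (X * (2 * (2 * (4 * d + 2 * d * c)) ^ c * (2 * d).+1)) < lam ^ m.
Proof.
have c1 := c_gt1.
have d0 : 0 < d by rewrite expn_gt0 ltnW.
have base : 2 * (4 * d + 2 * d * c) <= k ^ ((f + 20) * t3).
  apply: leq_trans (_ : 8 * (d * c) <= _); first by nia.
  apply: (@leq_pow_mul 3 (f * t3 + 17 * s)); first exact: leq_pow_const.
    by apply: (@leq_pow_mul (f * t3) (17 * s)); [exact: leqnn|exact: c_pow|by []].
  by lia.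
have d1 : (2 * d).+1 <= k ^ (2 + f * t3).
  apply: leq_trans (_ : 4 * d <= _); first by lia.
  by apply: (@leq_pow_mul 2 (f * t3)); [exact: leq_pow_const|exact: leqnn|by []].
have big : 128 * (X * (2 * (2 * (4 * d + 2 * d * c)) ^ c * (2 * d).+1)) <=
    k ^ (7 + (e * t2 + ((1 + (f + 20) * t3 * c) + (2 + f * t3)))).
  apply: leq_pow_mul (leqnn _); first exact: leq_pow_const.
  apply: leq_pow_mul (leqnn _); first exact: X_le_lam.
  apply: leq_pow_mul (leqnn _) => //.
  by apply: leq_pow_mul (leqnn _); [exact: leq_pow_const|exact: leq_pow_pow base _].
apply: leq_ltn_trans big _.
rewrite /lam -expnM ltn_exp2l //.
have m_ge : 19 * (s * c) <= m.
  apply: (@leq_pow_mul 5 (18 * s)); [exact: leq_pow_const| |lia].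
  by apply: (@leq_pow_mul s (17 * s)); [exact: s_pow|exact: c_pow|lia].
have h1 : (f + 20) * (t3 * c) <= 8 * e * (t3 * c) by rewrite leq_mul2r f_le orbT.
have h2 : f * t3 <= 8 * e * t3 by rewrite leq_mul2r; apply/orP; right; lia.
have h3 : e * t2 * (19 * (s * c)) <= e * t2 * m by rewrite leq_mul2l m_ge orbT.
have E : e * t2 * (19 * (s * c)) = 19 * (e * (t3 * c)) by rewrite /t2 /t3; lia.
have h4 : e * (t3 * 2) <= e * (t3 * c) by rewrite !leq_mul2l c1 !orbT.
have h5 : e * t2 <= e * t3 by rewrite leq_mul2l t23 orbT.
have h6 : 10 < e * t3.
  have t30 : 0 < t3 by rewrite !muln_gt0 s0.
  by apply: leq_trans (_ : e * 1 <= _); [lia|rewrite leq_mul2l t30 orbT].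
rewrite -mulnA; clear -h1 h2 h3 E h4 h5 h6; lia.
Qed.

Lemma dense_has_C4_free (G : sgraph) : biclique_free G s -> 0 < #|G| ->
  k ^ (f * t3) * #|G| <= epairs [set: G] [set: G] -> has_dense_C4_free G k.
Proof.
move=> fr G0 dG.
have k0 := ltnW k2.
have d1 : 1 < d by rewrite -(expn0 k) ltn_exp2l // muln_gt0; apply/andP; split; lia.
have [S [S0 dS spS]] := dense_sparse_subset d1 G0 dG.
have pow0 i : 0 < k ^ i by rewrite expn_gt0 k0.
apply: (@sparse_dense_C4_free G S d lam (ltnW d1) spS _ s k m P g K) => //.
- by have := lam_ge; have := pow0 (30 * s); rewrite -/m; lia.
- exact: pow0.
- exact: pow0.
- exact: lam_ge.
- exact: P_le_d.
- exact: K_ge.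
- exact: X_le_lam.
- exact: g_ge.
- exact: d_ge_g.
- exact: d_ge_c.
- exact: lam_gap.
Qed.

End PowersOfK.

Theorem theorem1p1 :
  exists C : nat, forall (s k : nat) (G : sgraph),
    free_of (Kmn s s) G ->
    ((k ^ (C * s ^ 3))%:R <= avg_degree G)%R ->
    exists S : {set G},
      free_of C4 (induced S) /\ (k%:R <= avg_degree (induced S))%R.
Proof.
(* The least f allowed by f >= 2h + 5, h >= 169 + 3e and e >= 7 * 58 + 5. *)
exists (2 * (169 + 3 * (7 * 58 + 5)) + 5) => s k G /free_biclique_free fr.
set C := (2 * _ + 5)%N => dG.
case: s => [|s] in fr dG *.
  (* Every graph contains the empty biclique, so s = 0 is vacuous. *)
  by case: (fr set0 set0); rewrite ?cards0 // => x y; rewrite inE.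
have [k0|k0] := posnP k.
  (* The empty graph has average degree 0 by convention. *)
  exists set0; rewrite k0; split; last by rewrite divr_ge0 ?ler0n.
  by apply: C4_free_induced => x1 x2 x3 x4; rewrite inE.
apply: has_dense_C4_free_induced.
have [G0|G0] := posnP #|G|.
  move: dG; rewrite /avg_degree G0 invr0 mulr0 lern0.
  by rewrite eqn0Ngt expn_gt0 k0.
move: dG; rewrite /avg_degree card_edges ler_pdivlMr ?ltr0n // -natrM ler_nat => dG.
(* Powers of 1 cannot absorb constants; for k = 1 a single edge is enough. *)
have [k1|k1] := leqP k 1.
  have -> : k = 1 by lia.
  have : 0 < epairs [set: G] [set: G].
    by apply: leq_trans dG; rewrite muln_gt0 expn_gt0 k0.
  rewrite lt0n sum_nat_eq0 negb_forall => /existsP[x].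
  rewrite negb_imply => /andP[_]; rewrite -lt0n => /card_gt0P[y]; rewrite in_nbr => /andP[_ xy].
  have nxy : x != y by apply: contraTneq xy => ->; rewrite adj_irrefl.
  exists [set x; y]; split.
  - move=> x1 x2 x3 x4 /set2P i1 /set2P i2 /set2P i3 _.
    apply/negP=> /and5P[a12 a23 _ _ /andP[n13 _]]; move: a12 a23 n13.
    by case: i1 => ->; case: i2 => ->; case: i3 => ->; rewrite ?adj_irrefl ?eqxx.
  - by rewrite cards2.
  - apply: epairs_geq => v /set2P[]->; apply/card_gt0P.
      by exists y; rewrite in_nbr !inE eqxx orbT.
    by exists x; rewrite in_nbr !inE eqxx adj_sym.
apply: (@dense_has_C4_free k s.+1 (7 * 58 + 5) (169 + 3 * (7 * 58 + 5)) C) => //.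
by rewrite (_ : s.+1 * s.+1 * s.+1 = s.+1 ^ 3) // !expnS expn0 muln1 mulnA.
Qed.
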